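(* The Borwein–Fabian norm on a weakly compactly generated Asplund space $X$ (i.e. an equivalent smooth norm $\|\cdot\|$ on $X$ such that $N(X,\|\cdot\|)=\{\pm x_0\}$ for some $x_0\in S(X,\|\cdot\|)$) has the hereditary Mazur intersection property, but is not Fréchet smooth. In particular, every Banach space with a separable dual, e.g. $c_0$, has an equivalent norm with the hereditary Mazur intersection property that is not Fréchet smooth.
   Context: All Banach spaces are real, and ''subspace'' means closed linear subspace (equipped with the restricted norm). $S(X)=\{x\in X:\|x\|=1\}$ and $X^*$ is the dual of $X$. For $x\in S(X)$, $D_X(x)=\{f\in S(X^* ): f(x)=1\}$; the multivalued map $D_X$ is the duality map. A point $x\in S(X)$ is a smooth point if $D_X(x)$ is a singleton; $X$ is smooth if every $x\in S(X)$ is a smooth point. A point $x\in S(X)$ is a Fréchet smooth point if $D_X$ is single-valued and norm-norm continuous at $x$; $X$ (or its norm) is Fréchet smooth if every $x\in S(X)$ is a Fréchet smooth point. $N(X)=N(X,\|\cdot\|)$ denotes the set of $x\in S(X)$ at which the norm is not Fréchet smooth. A Banach space has the Mazur intersection property (MIP) if every closed, bounded, convex set in it is the intersection of the closed balls containing it. $X$ has the hereditary MIP if $X$ and all its subspaces have MIP; a norm is said to have the hereditary MIP if the space equipped with it does. $X$ is weakly compactly generated (WCG) if there is a weakly compact $K\subseteq X$ with $\overline{\mathrm{span}}(K)=X$. A Banach space is Asplund if and only if every separable subspace of it has separable dual. A known theorem of Borwein and Fabian states that every infinite-dimensional WCG Asplund space $X$ admits an equivalent smooth norm $\|\cdot\|$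 such that $N(X,\|\cdot\|)=\{\pm x_0\}$ for some $x_0\in S(X,\|\cdot\|)$; such a norm is what is called the Borwein–Fabian norm.
   Formalization: ''Every Banach space with a separable dual'' is read as every infinite-dimensional one (in finite dimensions, e.g. the real line, hereditary MIP forces Fréchet smoothness, so the claim fails); the zero subspace is excluded from the hereditary MIP. *)

(* Defs.v *)
From HB Require Import structures.
From mathcomp Require Import all_boot all_order all_algebra.
From mathcomp Require Import all_classical all_reals all_analysis.

Set Implicit Arguments.
Unset Strict Implicit.
Unset Printing Implicit Defensive.

Import Order.TTheory GRing.Theory Num.Theory.
Import numFieldNormedType.Exports.

Local Open Scope classical_set_scope.
Local Open Scope ring_scope.

Section sup_norm.
Context {R : realType} {T : Type}.
Implicit Types (A : set T) (f g : T -> R^o).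

Definition sup_norm A f : R := sup [set `|f x| | x in A].

Lemma sup_norm_ge A f (M : R) x : (forall y, A y -> `|f y| <= M) -> A x ->
  `|f x| <= sup_norm A f.
Proof.
move=> fM Ax; apply: ub_le_sup; last by exists x.
by exists M => _ [y Ay <-]; exact: fM.
Qed.

Lemma sup_norm_le A f (M : R) : A !=set0 -> (forall y, A y -> `|f y| <= M) ->
  sup_norm A f <= M.
Proof.
move=> [x Ax] fM; apply: ge_sup; first by exists `|f x|, x.
by move=> _ [y Ay <-]; exact: fM.
Qed.

Lemma sup_normD A f g (M N : R) : A !=set0 ->
  (forall y, A y -> `|f y| <= M) -> (forall y, A y -> `|g y| <= N) ->
  sup_norm A (f + g) <= sup_norm A f + sup_norm A g.
Proof.
move=> A0 fM gN; apply: sup_norm_le => // y Ay.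
by rewrite (le_trans (ler_normD _ _))// lerD//; [exact: sup_norm_ge fM _
  | exact: sup_norm_ge gN _].
Qed.

Lemma sup_normZ A f (M a : R) : A !=set0 -> (forall y, A y -> `|f y| <= M) ->
  sup_norm A (a *: f) = `|a| * sup_norm A f.
Proof.
move=> A0 fM; have afM y : A y -> `|(a *: f) y| <= `|a| * sup_norm A f.
  by move=> Ay; rewrite normrM ler_wpM2l//; exact: sup_norm_ge fM _.
apply/eqP; rewrite eq_le sup_norm_le//=.
have [a0|a0] := eqVneq a 0.
  rewrite {1}a0 normr0 mul0r; have [x Ax] := A0.
  by rewrite (le_trans (normr_ge0 _) (sup_norm_ge afM Ax)).
rewrite mulrC -ler_pdivlMr ?normr_gt0//; apply: sup_norm_le => // y Ay.
rewrite ler_pdivlMr ?normr_gt0// mulrC -normrM.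
exact: (sup_norm_ge afM Ay).
Qed.

Lemma sup_norm_eq0 A f (M : R) : (forall y, A y -> `|f y| <= M) ->
  sup_norm A f = 0 -> forall x, A x -> f x = 0.
Proof.
move=> fM f0 x Ax; apply/eqP; rewrite -normr_le0 -f0.
exact: sup_norm_ge fM Ax.
Qed.

End sup_norm.

Section dual.
Context {R : realType} (X : normedModType R).

Definition dual_pred : {pred (X -> R^o)} :=
  fun f => `[< linear f /\ continuous f >].

Lemma dual_submod_closed : submod_closed dual_pred.
Proof.
split=> [|a f g /asboolP[lf cf] /asboolP[lg cg]]; apply/asboolP; split.
- by move=> k u v; rewrite /= scaler0 addr0.
- exact: cst_continuous.
- move=> k u v.
  rewrite -[LHS]/(a *: f (k *: u + v) + g (k *: u + v)).
  rewrite -[RHS]/(k *: (a *: f u + g u) + (a *: f v + g v)).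
  by rewrite lf lg !scalerDr !scalerA (mulrC a) addrACA.
- by move=> x; apply: cvgD; [apply: cvgZl_tmp; exact: cf|exact: cg].
Qed.

HB.instance Definition _ :=
  GRing.isSubmodClosed.Build R (X -> R^o) dual_pred dual_submod_closed.

Record dual : Type := Dual {
  dual_fun :> X -> R^o ; dualP : dual_fun \in dual_pred }.

HB.instance Definition _ := [isSub for dual_fun].
HB.instance Definition _ := gen_eqMixin dual.
HB.instance Definition _ := gen_choiceMixin dual.
HB.instance Definition _ := [SubChoice_isSubLmodule of dual by <:].

Definition dual_norm (f : dual) : R := sup_norm [set x : X | `|x| <= 1] f.

Lemma dual_bounded (f : dual) :
  exists M : R, forall x : X, `|x| <= 1 -> `|f x| <= M.
Proof.
have /asboolP[lf cf] := dualP f.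
pose fl : {linear X -> R^o} := HB.pack (f : X -> R^o)
  (GRing.isLinear.Build _ _ _ _ _ lf).
have /linear_boundedP : bounded_near fl (nbhs 0).
  exact/linear_bounded_continuous.
move=> /pinfty_ex_gt0[M M0 fM]; exists M => x x1.
by rewrite (le_trans (fM x))// ler_piMr// ltW.
Qed.

Let unit_ball0 : [set x : X | `|x| <= 1] !=set0.
Proof. by exists 0; rewrite /= normr0. Qed.

Lemma dual_normD f g : dual_norm (f + g) <= dual_norm f + dual_norm g.
Proof.
have [M fM] := dual_bounded f; have [N gN] := dual_bounded g.
exact: sup_normD fM gN.
Qed.

Lemma dual_normZ a f : dual_norm (a *: f) = `|a| * dual_norm f.
Proof. by have [M fM] := dual_bounded f; exact: sup_normZ fM. Qed.

Lemma dual_norm0_eq0 f : dual_norm f = 0 -> f = 0.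
Proof.
have [M fM] := dual_bounded f; have /asboolP[lf _] := dualP f.
have lfZ (k : R) x : f (k *: x) = k * f x.
  have f0 : f 0 = 0 by rewrite -(@addrI _ (f 0) (f 0) 0)// -{1}[f 0]scale1r
    -lf scale1r !addr0.
  by rewrite -[k *: x]addr0 lf f0 addr0.
move=> f0; apply: val_inj; apply/funext => x /=.
have [->|x0] := eqVneq x 0.
  by rewrite -(scale0r 0) lfZ mul0r.
have := sup_norm_eq0 fM f0 (x := `|x|^-1 *: x).
rewrite /= normfZV// lexx lfZ => /(_ isT)/eqP.
by rewrite mulf_eq0 invr_eq0 normr_eq0 (negPf x0) => /eqP.
Qed.

HB.instance Definition _ :=
  Lmodule_isNormed.Build R dual dual_normD dual_normZ dual_norm0_eq0.

End dual.

Section smoothness.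
Context {R : realType} (X : normedModType R).

Definition unit_sphere : set X := [set x | `|x| = 1].

Definition duality_map (x : X) : set (dual X) :=
  [set f : dual X | `|f| = 1 /\ f x = 1].

Definition smooth_point (x : X) := exists f, duality_map x = [set f].

Definition smooth := forall x, unit_sphere x -> smooth_point x.

(* The duality map lives on the unit sphere and may be multivalued at points
   [y != x], so continuity at [x] is required of all its selections. *)
Definition frechet_smooth_point (x : X) :=
  exists f, duality_map x = [set f] /\
    forall e : R, 0 < e ->
      \forall y \near x, unit_sphere y ->
        forall g, duality_map y g -> `|g - f| < e.

Definition frechet_smooth := forall x, unit_sphere x -> frechet_smooth_point x.

Definition non_frechet_set : set X :=
  [set x | unit_sphere x /\ ~ frechet_smooth_point x].

End smoothness.
Arguments unit_sphere {R} X.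
Arguments non_frechet_set {R} X.

Section closed_subspaces.
Context {R : realType} (X : normedModType R).

Record closed_subspace := ClosedSubspace {
  subspace_set :> set X ;
  subspace_submod_closed : submod_closed [in subspace_set] ;
  subspace_closed : closed subspace_set }.

Variable Y : closed_subspace.

Definition subspace_pred : {pred X} := [in subspace_set Y].

HB.instance Definition _ :=
  GRing.isSubmodClosed.Build R X subspace_pred (subspace_submod_closed Y).

(* The space [Y] with the restricted norm. *)
Record subspace_space : Type := SubspaceSpace {
  subspace_val :> X ; subspace_valP : subspace_val \in subspace_pred }.

HB.instance Definition _ := [isSub for subspace_val].
HB.instance Definition _ := [Choice of subspace_space by <:].
HB.instance Definition _ := [SubChoice_isSubLmodule of subspace_space by <:].

Definition subspace_norm (y : subspace_space) : R := `|subspace_val y|.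

Lemma subspace_normD x y :
  subspace_norm (x + y) <= subspace_norm x + subspace_norm y.
Proof. exact: ler_normD. Qed.

Lemma subspace_normZ a x : subspace_norm (a *: x) = `|a| * subspace_norm x.
Proof. exact: normrZ. Qed.

Lemma subspace_norm0_eq0 x : subspace_norm x = 0 -> x = 0.
Proof. by move=> /normr0_eq0 x0; exact: val_inj. Qed.

HB.instance Definition _ := Lmodule_isNormed.Build R subspace_space
  subspace_normD subspace_normZ subspace_norm0_eq0.

End closed_subspaces.

Section equivalent_norms.
Context {R : realType} (X : normedModType R).

Record equiv_norm := EquivNorm {
  enorm :> X -> R ;
  enormD : forall x y, enorm (x + y) <= enorm x + enorm y ;
  enormZ : forall a x, enorm (a *: x) = `|a| * enorm x ;
  enorm_equiv : exists m M : R, [/\ 0 < m, 0 < M &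
    forall x, m * `|x| <= enorm x /\ enorm x <= M * `|x|] }.

Lemma enorm0_eq0 (N : equiv_norm) x : N x = 0 -> x = 0.
Proof.
have [m [M [m0 _ mM]]] := enorm_equiv N.
have [+ _] := mM x => /[swap] ->.
by rewrite pmulr_rle0// normr_le0 => /eqP.
Qed.

(* The vector space [X] equipped with the norm [N]. *)
Definition renorm (N : equiv_norm) : Type := X.

Variable N : equiv_norm.

HB.instance Definition _ := GRing.Lmodule.copy (renorm N) X.
HB.instance Definition _ := Lmodule_isNormed.Build R (renorm N)
  (@enormD N) (@enormZ N) (@enorm0_eq0 N).

End equivalent_norms.

Section mazur.
Context {R : realType}.

Definition MIP (X : normedModType R) := forall C : set X,
  closed C -> bounded_set C -> @convex_set R X C ->
  C = \bigcap_(B in [set B | (exists c r, 0 < r /\ B = closed_ball c r) /\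
                             C `<=` B]) B.

(* The zero subspace is excluded: the empty set is closed, bounded and convex
   but is not an intersection of balls of a one-point space. *)
Definition hereditary_MIP (X : normedModType R) :=
  MIP X /\
  forall Y : closed_subspace X, (exists y : subspace_space Y, y != 0) ->
    MIP (subspace_space Y).

End mazur.

Definition separable (T : topologicalType) :=
  exists2 S : set T, countable S & dense S.

Section banach_classes.
Context {R : realType} (X : normedModType R).

(* The coarsest topology on [X] making every [f : dual X] continuous. *)
Definition weak : Type :=
  initial_topology
    ((fun x f => f x) : X -> {ptws (dual X) -> R^o}).

HB.instance Definition _ := Topological.on weak.

Definition weakly_compact (K : set X) := compact (K : set weak).

Definition linear_span (K : set X) : set X :=
  [set x | exists n (c : 'I_n -> R) (v : 'I_n -> X),
    (forall i, K (v i)) /\ x = \sum_(i < n) c i *: v i].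

Definition WCG := exists K : set X,
  weakly_compact K /\ closure (linear_span K) = setT.

(* Asplund spaces through their characterization by separable subspaces. *)
Definition Asplund := forall Y : closed_subspace X,
  separable (subspace_space Y) -> separable (dual (subspace_space Y)).

Definition infinite_dimensional := forall n (b : 'I_n -> X),
  ~ forall x, exists c : 'I_n -> R, x = \sum_(i < n) c i *: b i.

End banach_classes.

Section c0.
Context (R : realType).

Definition c0_pred : {pred (nat -> R^o)} :=
  fun u => `[< u @ \oo --> (0 : R^o) >].

Lemma c0_submod_closed : submod_closed c0_pred.
Proof.
split=> [|a u v /asboolP u0 /asboolP v0]; apply/asboolP; first exact: cvg_cst.
rewrite -[0]addr0 -{1}(scaler0 _ a); apply: cvgD => //.
exact: cvgZl_tmp.
Qed.

HB.instance Definition _ :=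
  GRing.isSubmodClosed.Build R (nat -> R^o) c0_pred c0_submod_closed.

Record c0 : Type := C0 { c0_seq :> nat -> R^o; c0P : c0_seq \in c0_pred }.

HB.instance Definition _ := [isSub for c0_seq].
HB.instance Definition _ := gen_eqMixin c0.
HB.instance Definition _ := gen_choiceMixin c0.
HB.instance Definition _ := [SubChoice_isSubLmodule of c0 by <:].

Definition c0_norm (u : c0) : R := sup_norm [set: nat] u.

Lemma c0_bounded (u : c0) : exists M : R, forall n, [set: nat] n -> `|u n| <= M.
Proof.
have /asboolP u0 := c0P u.
have /cvg_seq_bounded/pinfty_ex_gt0[M _ uM] : cvgn (u : nat -> R^o).
  by apply/cvg_ex; exists 0.
by exists M => n _; exact: uM.
Qed.

Let nat0 : [set: nat] !=set0. Proof. by exists 0%N. Qed.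

Lemma c0_normD u v : c0_norm (u + v) <= c0_norm u + c0_norm v.
Proof.
have [M uM] := c0_bounded u; have [N vN] := c0_bounded v.
exact: sup_normD uM vN.
Qed.

Lemma c0_normZ a u : c0_norm (a *: u) = `|a| * c0_norm u.
Proof. by have [M uM] := c0_bounded u; exact: sup_normZ uM. Qed.

Lemma c0_norm0_eq0 u : c0_norm u = 0 -> u = 0.
Proof.
have [M uM] := c0_bounded u => u0.
by apply: val_inj; apply/funext => n; exact: (sup_norm_eq0 uM u0).
Qed.

HB.instance Definition _ :=
  Lmodule_isNormed.Build R c0 c0_normD c0_normZ c0_norm0_eq0.

Lemma c0_norm_ge (u : c0) n : `|u n| <= `|u|.
Proof. by have [M uM] := c0_bounded u; exact: sup_norm_ge uM _. Qed.

Lemma c0_norm_le (u : c0) (M : R) : (forall n, `|u n| <= M) -> `|u| <= M.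
Proof. by move=> uM; apply: sup_norm_le. Qed.

Lemma c0_complete (F : set_system c0) : ProperFilter F -> cauchy F -> cvg F.
Proof.
move=> FF Fc.
have Fe (e : R) : 0 < e -> exists u : c0, \forall v \near F, `|u - v| < e.
  move=> e0; have /cauchyP/(_ e e0)[u Fu] := Fc.
  by exists u; apply: filterS Fu => v; rewrite -ball_normE.
have coordB (u v : c0) n : `|u n - v n| <= `|u - v|.
  exact: (c0_norm_ge (u - v) n).
pose l : nat -> R^o := fun n => lim ((v : c0) n @[v --> F]).
have Fl n : (v : c0) n @[v --> F] --> l n.
  apply: cauchy_cvg; apply/cauchyP => e e0.
  have [u Fu] := Fe _ e0; exists (u n).
  apply: filterS Fu => v uv /=; rewrite -ball_normE/=.
  exact: le_lt_trans (coordB u v n) uv.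
have ul (e : R) (u : c0) : (\forall v \near F, `|u - v| < e) ->
    forall n, `|u n - l n| <= e.
  move=> Fu n.
  have ln : `|u n - (v : c0) n| @[v --> F] --> (`|u n - l n| : R).
    by apply: cvg_norm; apply: cvgB => //; exact: cvg_cst.
  rewrite -(cvg_lim _ ln)//; apply: limr_le.
    by apply/cvg_ex; eexists; exact: ln.
  by apply: filterS Fu => v uv; exact: le_trans (coordB _ _ n) (ltW uv).
have l0 : l \in c0_pred.
  apply/asboolP/cvgr0Pnorm_lt => e e0.
  have e20 : 0 < e / 2 by rewrite divr_gt0.
  have [u Fu] := Fe _ e20.
  have /asboolP/cvgr0Pnorm_lt/(_ _ e20) u0 := c0P u.
  near=> n; rewrite -[l n](subKr (u n)) [ltRHS]splitr.
  by rewrite (le_lt_trans (ler_normB _ _))// ltr_leD//; [near: n|exact: ul].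
apply/cvg_ex; exists (C0 l0); apply/cvgrPdist_le => e e0.
have e20 : 0 < e / 2 by rewrite divr_gt0.
have [u Fu] := Fe _ e20.
near=> v; rewrite -[_ - _](subrKA u) [leRHS]splitr.
rewrite (le_trans (ler_normD _ _))// lerD//.
  by rewrite distrC; apply: c0_norm_le => n; exact: ul.
by apply: ltW; near: v.
Unshelve. all: by end_near. Qed.

HB.instance Definition _ := Uniform_isComplete.Build c0 c0_complete.

End c0.

(* Main.v *)
(* Hereditary MIP. Away from +-x0 the norm is Frechet differentiable in the
   uniform sense |x + h| + |x - h| - 2 |x| = o(|h|), which passes to subspaces,
   while x0 has only one support functional, also in subspaces (Hahn-Banach). By
   Bishop-Phelps a functional separating a point from a bounded closed convex
   set can be replaced by a support functional at a Frechet point: one first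
   moves it off the line spanned by the exceptional functional. At a Frechet
   point Mazur's large ball argument applies.

   Existence. Let X be infinite-dimensional with separable dual, f0(x0) = 1 =
   |f0| = |x0|. Let Q be a square of a dual LUR norm on X* and p a weak*
   continuous (on bounded sets) seminorm with kernel R f0. The weak* compact set
     a^2 + p^2 / (2 - Q) <= 1,   a(f) = f(x0),
   is the dual unit ball of an equivalent norm. Where p > 0 the function is
   strictly increasing in Q, so such points are strongly exposed by the points
   where they attain their norm. At f0 the dependence on Q disappears: f0 is
   exposed by x0, but f0 + g_n/8 is nearly in the ball for any normalized g_n
   with g_n(x0) = 0 and p(g_n) -> 0, so the norm is smooth but not Frechet smooth
   at x0. Such g_n exist since X is infinite-dimensional. *)

From HB Require Import structures.
Require Import Defs.
From mathcomp Require Import all_boot all_order all_algebra.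
From mathcomp Require Import all_classical all_reals all_analysis.
From mathcomp Require Import ring lra.
Import Order.TTheory GRing.Theory Num.Theory.
Import numFieldNormedType.Exports.
Local Open Scope classical_set_scope.
Local Open Scope ring_scope.

(** * Hahn-Banach *)

Section linear_functionals.
Context {R : realType} {X : lmodType R}.
Implicit Types (f g p q : X -> R) (x y z : X) (S : X -> R -> Prop).

Definition lin f := forall (a : R) u v, f (a *: u + v) = a * f u + f v.

Lemma lin0 f : lin f -> f 0 = 0.
Proof.
by move=> lf; have := lf 1 0 0; rewrite scaler0 addr0 mul1r => h; lra.
Qed.

Lemma linZ f a x : lin f -> f (a *: x) = a * f x.
Proof. by move=> lf; rewrite -[a *: x]addr0 lf lin0// addr0. Qed.

Lemma linD f x y : lin f -> f (x + y) = f x + f y.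
Proof. by move=> lf; rewrite -[x]scale1r lf mul1r scale1r. Qed.

Lemma linN f x : lin f -> f (- x) = - f x.
Proof. by move=> lf; rewrite -scaleN1r linZ// mulN1r. Qed.

Lemma linB f x y : lin f -> f (x - y) = f x - f y.
Proof. by move=> lf; rewrite linD// linN. Qed.

Lemma lin_comb f g a b : lin f -> lin g -> lin (fun x => a * f x + b * g x).
Proof. by move=> lf lg k u v; rewrite lf lg; ring. Qed.

Definition sublinear p :=
  (forall x y, p (x + y) <= p x + p y) /\
  (forall (t : R) x, 0 <= t -> p (t *: x) = t * p x).

Lemma sublinear0 p : sublinear p -> p 0 = 0.
Proof. by move=> [_ pZ]; rewrite -(scale0r 0) pZ// mul0r. Qed.

Lemma sublinear_ge p x : sublinear p -> - p (- x) <= p x.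
Proof.
move=> sp; have := sp.1 x (- x); rewrite subrr sublinear0// => ?; lra.
Qed.

Definition convex_rel S := forall x y (a b t : R), S x a -> S y b -> 0 <= t <= 1 ->
  S (t *: x + (1 - t) *: y) (t * a + (1 - t) * b).

(* The largest sublinear function below [p] whose linear minorants are the
   linear minorants [h] of [p] with [h x >= a] for all [(x, a)] in [S]. *)
Definition cone_inf p S z :=
  inf [set e | exists (t : R) (x : X) (a : R),
    [/\ (0 : R) <= t, S x a & e = p (z + t *: x) - t * a]].

Section cone_inf.
Variables (p : X -> R) (S : X -> R -> Prop).
Hypotheses (sp : sublinear p) (S0 : exists x a, S x a) (cS : convex_rel S)
  (Sp : forall x a, S x a -> a <= p x).

Let lbS z : lbound [set e | exists t x a,
  [/\ (0 : R) <= t, S x a & e = p (z + t *: x) - t * a]] (- p (- z)).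
Proof.
move=> _ [t [x [a [t0 Sxa ->]]]]; have := sp.1 (z + t *: x) (- z).
rewrite (addrC z) addrK sp.2//.
have := ler_wpM2l t0 (Sp _ _ Sxa) => h1 h2; lra.
Qed.

Lemma cone_inf_le (t : R) x a z : 0 <= t -> S x a ->
  cone_inf p S z <= p (z + t *: x) - t * a.
Proof.
move=> t0 Sxa; apply: ge_inf; last by exists t, x, a.
by exists (- p (- z)); exact: lbS.
Qed.

Lemma cone_inf_ge c z :
  (forall (t : R) (x : X) (a : R), 0 <= t -> S x a -> c <= p (z + t *: x) - t * a) ->
  c <= cone_inf p S z.
Proof.
move=> cle; apply: lb_le_inf.
  have [x [a Sxa]] := S0; exists (p (z + 0 *: x) - 0 * a).
  by exists 0, x, a.
by move=> _ [t [x [a [t0 Sxa ->]]]]; exact: cle.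
Qed.

Lemma cone_inf_lep z : cone_inf p S z <= p z.
Proof.
have [x [a Sxa]] := S0.
by have := cone_inf_le 0 x a z (lexx _) Sxa; rewrite scale0r addr0 mul0r subr0.
Qed.

Lemma cone_infN x a : S x a -> cone_inf p S (- x) <= - a.
Proof.
move=> Sxa; have := cone_inf_le 1 x a (- x) ler01 Sxa.
by rewrite scale1r addNr sublinear0// mul1r sub0r.
Qed.

(** Subadditivity comes from the convexity of [S]: for [t + s > 0], [t *: u + s *: v] is [t + s]
    times a convex combination, hence admissible in the infimum at [x + y]. *)
Lemma cone_inf_sublinear : sublinear (cone_inf p S).
Proof.
have ZM t x : 0 < t -> t * cone_inf p S x <= cone_inf p S (t *: x).
  move=> t0; apply: cone_inf_ge => s y a s0 Sya.
  have := cone_inf_le (t^-1 * s) y a x.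
  rewrite mulr_ge0 ?invr_ge0 ?(ltW t0)// => /(_ isT Sya).
  rewrite -(ler_pM2l t0) => /le_trans; apply.
  rewrite mulrBr -sp.2 ?(ltW t0)// scalerDr scalerA !mulrA divff ?gt_eqF// !mul1r.
  by [].
split=> [x y|t x].
  rewrite -lerBlDr; apply: cone_inf_ge => t u a t0 Sua.
  rewrite lerBlDr -lerBlDl; apply: cone_inf_ge => s v b s0 Svb.
  rewrite lerBlDl; have [ts0|ts0] := eqVneq (t + s) 0.
    have [-> ->] : t = 0 /\ s = 0 by split; lra.
    rewrite !scale0r !addr0 !mul0r !subr0.
    exact: le_trans (cone_inf_lep _) (sp.1 _ _).
  have ts : 0 < t + s by rewrite lt_def ts0 addr_ge0.
  have tt : 0 <= t / (t + s) <= 1.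
    by rewrite divr_ge0 ?(ltW ts)//= ler_pdivrMr// mul1r lerDl.
  have := cone_inf_le (t + s) _ _ (x + y) (ltW ts) (cS _ _ _ _ _ Sua Svb tt).
  have -> : (t + s) *: (t / (t + s) *: u + (1 - t / (t + s)) *: v) =
      t *: u + s *: v.
    by rewrite scalerDr !scalerA; congr (_ *: _ + _ *: _); field.
  have -> : (t + s) * (t / (t + s) * a + (1 - t / (t + s)) * b) =
      t * a + s * b by field.
  move=> /le_trans; apply.
  rewrite addrACA; have := sp.1 (x + t *: u) (y + s *: v) => ?; lra.
rewrite le_eqVlt => /predU1P[<-|t0].
  rewrite scale0r mul0r; apply/eqP; rewrite eq_le.
  rewrite (le_trans (cone_inf_lep 0)) ?(sublinear0 p sp)//=.
  apply: cone_inf_ge => s y a s0 Sya; rewrite add0r sp.2//.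
  by rewrite subr_ge0 ler_wpM2l// Sp.
apply/eqP; rewrite eq_le ZM// andbT.
have := ZM t^-1 (t *: x); rewrite invr_gt0 scalerA mulVf ?gt_eqF// scale1r.
by move=> /(_ t0); rewrite -(ler_pM2l t0) mulrA divff ?gt_eqF// mul1r.
Qed.

End cone_inf.

(* Apply minimality to the largest sublinear function below [p] that is at most
   [- p a] at [- a]: it forces [p (- a) <= - p a]. *)
Lemma minimal_sublinear_lin p : sublinear p ->
  (forall q, sublinear q -> (forall x, q x <= p x) -> forall x, q x = p x) ->
  lin p.
Proof.
move=> sp pmin.
have pN a : p (- a) = - p a.
  apply/eqP; rewrite eq_le; apply/andP; split; last first.
    by have := sublinear_ge p (- a) sp; rewrite opprK.
  pose S x b := x = a /\ b = p a.
  have S0 : exists x b, S x b by exists a, (p a).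
  have cS : convex_rel S.
    move=> x y b c t [-> ->] [-> ->] _; split.
      by rewrite -scalerDl subrKC scale1r.
    by rewrite -mulrDl subrKC mul1r.
  have Sp x b : S x b -> b <= p x by case=> -> ->.
  rewrite -(pmin (cone_inf p S)); first exact: cone_infN.
    exact: cone_inf_sublinear.
  exact: cone_inf_lep.
have pD x y : p (x + y) = p x + p y.
  apply/eqP; rewrite eq_le sp.1/=.
  have := sp.1 (- x) (- y); rewrite -opprD !pN => ?; lra.
move=> a u v; rewrite pD; congr (_ + _).
have [a0|a0] := leP 0 a; first exact: sp.2.
by rewrite -{1}[a]opprK scaleNr pN sp.2 ?oppr_ge0 ?(ltW a0)// mulNr opprK.
Qed.

(** Zorn's lemma for the reversed pointwise order: a chain is bounded by its pointwise infimum,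
    which is finite because every member is at least [- p (- x)] at [x]. A minimal sublinear
    function is linear. *)
Lemma hahn_banach p : sublinear p ->
  exists h, lin h /\ forall x, h x <= p x.
Proof.
move=> sp; pose T := {q : X -> R | sublinear q /\ forall x, q x <= p x}.
pose le (s t : T) := `[< forall x, sval t x <= sval s x >].
have [||||[q [sq qp]] qmin] := @Zorn T le.
- by move=> t; apply/asboolP.
- move=> r s t /asboolP rs /asboolP st; apply/asboolP => x.
  exact: le_trans (st x) (rs x).
- move=> [s sP] [t tP] /asboolP st /asboolP ts.
  have st' : s = t.
    by apply/funext => x; apply/le_anti/andP; split; [exact: ts|exact: st].
  by case: _ / st' tP {st ts} => tP; congr exist; exact: Prop_irrelevance.
- move=> A Atot; have [->|/set0P A0] := eqVneq A set0.
    by exists (exist _ p (conj sp (fun=> lexx _))).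
  pose I x := [set sval t x | t in A].
  have lbI x : has_lbound (I x).
    exists (- p (- x)) => _ [t At <-]; have [st tp] := svalP t.
    by apply: le_trans (sublinear_ge _ _ st); rewrite lerN2.
  have Ile t x : A t -> inf (I x) <= sval t x.
    by move=> At; apply: ge_inf => //; exists t.
  have Ige c x : (forall t, A t -> c <= sval t x) -> c <= inf (I x).
    move=> cle; apply: lb_le_inf; last by move=> _ [t At <-]; exact: cle.
    by have [t At] := A0; exists (sval t x), t.
  have ZM t x : 0 < t -> t * inf (I x) <= inf (I (t *: x)).
    move=> t0; apply: Ige => s As; rewrite (svalP s).1.2 ?(ltW t0)// ler_pM2l//.
    exact: Ile.
  have sI : sublinear (fun x => inf (I x)).
    split=> [x y|t x].
      rewrite -lerBlDr; apply: (Ige) => s As; rewrite lerBlDr -lerBlDl.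
      apply: Ige => t At; rewrite lerBlDl.
      have [/asboolP st|/asboolP ts] := Atot s t As At.
        apply: le_trans (Ile t _ At) _; apply: le_trans ((svalP t).1.1 _ _) _.
        exact: lerD.
      apply: le_trans (Ile s _ As) _; apply: le_trans ((svalP s).1.1 _ _) _.
      exact: lerD.
    rewrite le_eqVlt => /predU1P[<-|t0].
      rewrite scale0r mul0r; apply/eqP; rewrite eq_le; apply/andP; split.
        have [s As] := A0; rewrite -(sublinear0 _ (svalP s).1); exact: Ile.
      by apply: Ige => s As; rewrite (sublinear0 _ (svalP s).1).
    apply/eqP; rewrite eq_le ZM// andbT.
    have := ZM t^-1 (t *: x); rewrite invr_gt0 scalerA mulVf ?gt_eqF// scale1r.
    by move=> /(_ t0); rewrite -(ler_pM2l t0) mulrA divff ?gt_eqF// mul1r.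
  have Ip x : inf (I x) <= p x.
    by have [t At] := A0; exact: le_trans (Ile t x At) ((svalP t).2 x).
  exists (exist _ (fun x => inf (I x)) (conj sI Ip)) => s As.
  by apply/asboolP => x /=; exact: Ile.
exists q; split=> //; apply: minimal_sublinear_lin => // r sr rq x.
have rp y : r y <= p y by exact: le_trans (rq y) (qp y).
suff /(congr1 sval)/= -> : exist _ r (conj sr rp) = exist _ q (conj sq qp) :> T.
  by [].
by apply: qmin; apply/asboolP.
Qed.

(** One form of Hahn-Banach for norming, separation and extension, each given by a choice of [S]. A
    linear minorant [h] of [cone_inf p S] satisfies [h (- x) <= - a] on [S]. *)
Lemma mazur_orlicz p S : sublinear p -> (exists x a, S x a) -> convex_rel S ->
  (forall x a, S x a -> a <= p x) ->
  exists h, [/\ lin h, forall x, h x <= p x & forall x a, S x a -> a <= h x].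
Proof.
move=> sp S0 cS Sp; have [h [lh hq]] := hahn_banach _
  (cone_inf_sublinear _ _ sp S0 cS Sp).
exists h; split=> // [x|x a Sxa].
  exact: le_trans (hq x) (cone_inf_lep _ _ sp S0 Sp x).
by rewrite -lerN2 -linN//; exact: le_trans (hq _) (cone_infN _ _ sp Sp _ _ Sxa).
Qed.

End linear_functionals.

(** * Bishop-Phelps *)

Section normed_spaces.
Context {R : realType} (E : normedModType R).
Implicit Types (f g : E -> R) (x y z : E).

(** Phrased by sequences and norms only, so that it passes directly to closed subspaces and to
    equivalent norms. *)
Definition seq_complete := forall u : nat -> E,
  (forall e : R, 0 < e -> exists n0, forall n, (n0 <= n)%N -> `|u n - u n0| < e) ->
  exists l, forall e : R, 0 < e ->
    exists n0, forall n, (n0 <= n)%N -> `|u n - l| < e.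

(* Equivalent to Frechet differentiability of the norm at [x], and visibly
   inherited by subspaces. *)
Definition norm_frechet x := forall e : R, 0 < e -> exists2 d : R, 0 < d &
  forall h : E, `|h| < d -> `|x + h| + `|x - h| - 2 * `|x| <= e * `|h|.

(** [f] is a plain function, so that functionals on different spaces or for different norms can be
    compared by values. *)
Definition supports f x := [/\ lin f, forall z, f z <= `|z| & f x = 1].

Lemma sublinear_normr (e : R) : 0 <= e -> sublinear (fun x : E => e * `|x|).
Proof.
move=> e0; split=> [x y|t x t0]; first by rewrite -mulrDr ler_wpM2l// ler_normD.
by rewrite normrZ ger0_norm// mulrCA.
Qed.

Lemma sublinear_norm : sublinear (fun x : E => `|x|).
Proof.
by split=> [x y|t x t0]; [exact: ler_normD|rewrite normrZ ger0_norm].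
Qed.

Lemma lin_le_norm f (M : R) : lin f -> (forall z, f z <= M * `|z|) ->
  forall z, `|f z| <= M * `|z|.
Proof.
move=> lf fle z; rewrite ler_norml fle andbT lerNl -linN// -normrN.
exact: fle.
Qed.

Lemma lin_le_norm1 f : lin f -> (forall z, f z <= `|z|) ->
  forall z, `|f z| <= `|z|.
Proof.
move=> lf fle z; rewrite -[leRHS]mul1r; apply: lin_le_norm => // y.
by rewrite mul1r.
Qed.

Lemma norming x : exists f, [/\ lin f, forall z, f z <= `|z| & f x = `|x|].
Proof.
pose S (z : E) (a : R) := z = x /\ a = `|x|.
have [||||f [lf fle fS]] := @mazur_orlicz _ _ (fun z : E => `|z|) S.
- exact: sublinear_norm.
- by exists x, `|x|.
- move=> y z a b t [-> ->] [-> ->] _; split.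
    by rewrite -scalerDl subrKC scale1r.
  by rewrite -mulrDl subrKC mul1r.
- by move=> z a [-> ->].
by exists f; split=> //; apply/le_anti; rewrite fle fS.
Qed.

Lemma supportsP x : `|x| = 1 -> exists f, supports f x.
Proof.
by move=> x1; have [f [lf fle fx]] := norming x; exists f; split; rewrite // fx.
Qed.

(** Ekeland's variational principle on the unit ball. A move along [G] gains at least [e] times its
    length; the greedy sequence is Cauchy since [f] is bounded, and its limit is maximal. *)
Lemma ekeland f (e : R) : seq_complete -> 0 < e -> lin f ->
    (forall z, f z <= `|z|) ->
  exists x, `|x| <= 1 /\ forall y, `|y| <= 1 -> f y - f x <= e * `|y - x|.
Proof.
move=> Ec e0 lf fle.
pose G x y := `|y| <= 1 /\ e * `|y - x| <= f y - f x.
have Gtrans x y z : G x y -> G y z -> G x z.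
  move=> [_ xy] [z1 yz]; split=> //.
  have := ler_wpM2l (ltW e0) (ler_distD y z x); rewrite mulrDr => h; lra.
(* [s x] gains at least half of the possible increase of [f] over [G x]. *)
have /choice[s sP] x : exists y, `|x| <= 1 ->
    G x y /\ forall z, G x z -> f z - f y <= f y - f x.
  have [x1|] := boolP (`|x| <= 1); last by exists x.
  have Gx : G x x by split=> //; rewrite !subrr normr0 mulr0.
  have [[z [Gz fz]]|h] := pselect (exists z, G x z /\ f x < f z); last first.
    exists x => _; split=> // z Gz; rewrite subrr subr_le0 leNgt.
    by apply/negP => fz; apply: h; exists z.
  pose F := [set f z | z in G x].
  have F0 : F !=set0 by exists (f x), x.
  have Fub : has_ubound F.
    by exists 1 => _ [y [y1 _] <-]; exact: le_trans (fle y) y1.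
  have fF y : G x y -> f y <= sup F by move=> Gy; apply: ub_le_sup => //; exists y.
  have d0 : 0 < (sup F - f x) / 2 by have := fF _ Gz => ?; lra.
  have [_ [y Gy <-] hy] := sup_adherent d0 (conj F0 Fub).
  by exists y => _; split=> // w Gw; have := fF _ Gw => ?; lra.
pose u n := iter n s 0.
have u1 n : `|u n| <= 1.
  elim: n => [|n IH]; first by rewrite normr0.
  by have [[]] := sP _ IH.
have uG n m : (n <= m)%N -> G (u n) (u m).
  elim: m => [|m IH]; first by rewrite leqn0 => /eqP ->; split; rewrite // !subrr normr0 mulr0.
  rewrite leq_eqVlt => /predU1P[->|].
    by split; rewrite // !subrr normr0 mulr0.
  by rewrite ltnS => /IH/Gtrans; apply; have [] := sP _ (u1 m).
pose F := range (fun n => f (u n)).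
have F0 : F !=set0 by exists (f (u 0)), 0.
have Fub : has_ubound F.
  by exists 1 => _ [n _ <-]; exact: le_trans (fle _) (u1 n).
have fF n : f (u n) <= sup F by apply: ub_le_sup => //; exists n.
have fFlt (d : R) : 0 < d -> exists n, sup F - d < f (u n).
  by move=> d0; have [_ [n _ <-] ?] := sup_adherent d0 (conj F0 Fub); exists n.
have [d d0|l ul] := Ec u.
  have [n0 hn0] := fFlt _ (mulr_gt0 e0 d0); exists n0 => n n0n.
  rewrite -(ltr_pM2l e0).
  by have := (uG _ _ n0n).2; have := fF n => h1 h2; lra.
have Gl n : G (u n) l.
  split; apply/ler_addgt0Pr => d d0.
    have [n0 /(_ n0 (leqnn _))] := ul _ d0; rewrite distrC.
    have := ler_normD (l - u n0) (u n0); rewrite subrK.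
    by have := u1 n0 => h1 h2 h3; lra.
  have d0' : 0 < d / (e + 1) by rewrite divr_gt0// ltr_wpDl// ltW.
  have [n0 /(_ (maxn n n0) (leq_maxr _ _))] := ul _ d0'.
  rewrite ltr_pdivlMr ?ltr_wpDl ?(ltW e0)//.
  set m := maxn n n0 => hm.
  have := (uG n m (leq_maxl _ _)).2.
  have := ler_wpM2l (ltW e0) (ler_distD (u m) l (u n)).
  have := fle (u m - l); rewrite linB// mulrDr (distrC l (u m)) => h1 h2 h3.
  lra.
exists l; split=> [|y y1]; first by have [] := Gl 0.
rewrite leNgt; apply/negP => hy.
have d0 : 0 < f y - f l by rewrite (le_lt_trans _ hy)// mulr_ge0// ltW.
have Gy n : G (u n) y by apply: Gtrans (Gl n) _; split; rewrite // ltW.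
(* The gain left after [u n] is below [f y - f l], so the greedy choice gives [f (u n.+1) > f l],
   against [Gl n.+1]. *)
have [n hn] := fFlt _ d0.
have [_ /(_ y (Gy n))] := sP _ (u1 n).
rewrite -[s (u n)]/(u n.+1).
have := fF n.+1; have := (Gl n.+1).2.
have : 0 <= e * `|l - u n.+1| by rewrite mulr_ge0// ltW.
move=> h1 h2 h3 h4.
have hl : f l <= sup F + 0.
  apply/ler_addgt0Pr => d dd0; rewrite addr0.
  have [n0 /(_ n0 (leqnn _)) h] := ul _ dd0.
  have := fle (l - u n0); rewrite linB// distrC.
  by have := fF n0 => h5 h6; lra.
lra.
Qed.

(** At Ekeland's point [x], [f] is below [e] times the norm on the ball translated by [- x]. A
    linear [h] between the two, subtracted from [f], leaves a functional that attains its maximum on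
    the ball at [x]. *)
Lemma bishop_phelps f (e : R) : seq_complete -> 0 < e -> lin f ->
    (forall z, f z <= `|z|) ->
  exists g x, [/\ lin g, `|x| <= 1, forall y, `|y| <= 1 -> g y <= g x &
    forall z, `|f z - g z| <= e * `|z|].
Proof.
move=> Ec e0 lf fle; have [x [x1 xmax]] := ekeland f e Ec e0 lf fle.
pose S (z : E) (a : R) := `|x + z| <= 1 /\ a = f z.
have [||||h [lh hle hS]] := @mazur_orlicz _ _ (fun z : E => e * `|z|) S.
- exact: sublinear_normr (ltW e0).
- by exists 0, 0; split; rewrite ?addr0 ?lin0.
- move=> y z a b t [y1 ->] [z1 ->] /andP[t0 t1]; split.
    have -> : x + (t *: y + (1 - t) *: z) = t *: (x + y) + (1 - t) *: (x + z).
      by rewrite !scalerDr addrACA -scalerDl subrKC scale1r.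
    rewrite (le_trans (ler_normD _ _))// !normrZ !ger0_norm ?subr_ge0//.
    have t1' : 0 <= 1 - t by lra.
    by have := ler_wpM2l t0 y1; have := ler_wpM2l t1' z1 => h1 h2; lra.
  by rewrite (linD f)// !(linZ f)//.
- by move=> z a [z1 ->]; have := xmax _ z1; rewrite (addrAC x) subrr add0r (linD f)// => h; lra.
exists (fun z => 1 * f z + (-1) * h z), x; split=> //.
- exact: lin_comb.
- move=> y y1; have := hS (y - x) (f (y - x)); rewrite /S subrKC => /(_ (conj y1 erefl)).
  by rewrite !linB// => h1; lra.
- move=> z; rewrite (_ : _ - _ = h z); last by ring.
  exact: lin_le_norm.
Qed.

End normed_spaces.

(** * The Mazur intersection property *)

Section mazur_intersection.
Context {R : realType} (E : normedModType R).
Implicit Types (f g : E -> R) (x y z : E) (C : set E).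

(** Bishop-Phelps for a functional bounded below on [C]; [c] is the norm of the functional found,
    which is divided out. *)
Lemma support_near f C (d K e : R) : seq_complete E -> 0 < e -> lin f ->
    (forall z, f z <= `|z|) -> 0 < d -> C !=set0 -> (forall z, C z -> d <= f z) ->
    (forall z, C z -> `|z| <= K) ->
  exists y g (a c : R), [/\ `|y| = 1, supports E g y, 0 < a,
    forall z, C z -> a <= g z & 0 < c /\ forall z, `|f z - c * g z| <= e * `|z|].
Proof.
move=> Ec e0 lf fle d0 [z0 Cz0] Cd CK.
have K0 : 0 < K.
  by have := CK _ Cz0; have := fle z0; have := Cd _ Cz0 => ? ? ?; lra.
(* The second bound changes [f] by at most [d / 2] on [C], so positivity survives there. *)
pose e' := Num.min e (d / (2 * K)).
have e'0 : 0 < e' by rewrite lt_min e0 divr_gt0// mulr_gt0.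
have [g [x [lg x1 gmax fg]]] := bishop_phelps _ f e' Ec e'0 lf fle.
have Cg z : C z -> d / 2 <= g z.
  move=> Cz; have := fg z; rewrite ler_norml => /andP[_ h].
  have : e' * `|z| <= d / (2 * K) * K.
    by rewrite ler_pM// ?(ltW e'0)// ?ge_min ?lexx ?orbT//; exact: CK.
  have -> : d / (2 * K) * K = d / 2 by field; rewrite gt_eqF.
  by have := Cd _ Cz => h1 h2; lra.
have gle z : z != 0 -> g z <= g x * `|z|.
  move=> zn0; have nz : 0 < `|z| by rewrite normr_gt0.
  rewrite -ler_pdivrMr// mulrC -linZ//; apply: gmax.
  by rewrite normfZV.
have z0n0 : z0 != 0.
  by apply/eqP => z00; have := Cd _ Cz0; rewrite z00 lin0// leNgt d0.
have gx0 : 0 < g x.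
  rewrite -(pmulr_lgt0 _ (x := `|z0|)) ?normr_gt0//.
  by apply: lt_le_trans (gle _ z0n0); apply: lt_le_trans (Cg _ Cz0); lra.
have xn0 : x != 0.
  by apply/eqP => x0; move: gx0; rewrite x0 lin0// ltxx.
have xx : `|x| = 1.
  by have := gle _ xn0; rewrite ler_pMr// => h; apply/le_anti; rewrite x1.
exists x, (fun z => (g x)^-1 * g z + 0 * g z), (d / 2 / g x), (g x); split.
- by [].
- split; [exact: lin_comb| |by rewrite mul0r addr0 mulVf ?gt_eqF].
  move=> z; rewrite mul0r addr0; have [->|zn0] := eqVneq z 0.
    by rewrite lin0// mulr0 normr0.
  by rewrite mulrC ler_pdivrMr// mulrC gle.
- by rewrite !divr_gt0.
- by move=> z Cz; rewrite mul0r addr0 mulrC ler_wpM2l ?invr_ge0 ?(ltW gx0)// Cg.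
- split=> // z; rewrite mul0r addr0 mulrA divff ?gt_eqF// mul1r.
  by rewrite (le_trans (fg z))// ler_wpM2r// ge_min lexx.
Qed.

Section main.
Variable f0 : E -> R.
Hypotheses (lf0 : lin f0) (Ec : seq_complete E).
Hypothesis fr : forall y, `|y| = 1 -> norm_frechet E y \/
  forall g, supports E g y -> (forall z, g z = f0 z) \/ (forall z, g z = - f0 z).

(** At a non-Frechet point the support functionals are [f0] or [- f0]. So it suffices to approximate
    a functional that is not zero on the kernel of [f0]; if [f] is zero there, it is first tilted
    slightly. *)
Lemma frechet_support f C (d K : R) : lin f -> (forall z, f z <= `|z|) ->
    0 < d -> C !=set0 -> (forall z, C z -> d <= f z) ->
    (forall z, C z -> `|z| <= K) ->
  exists y g (a : R), [/\ `|y| = 1, norm_frechet E y, supports E g y, 0 < a &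
    forall z, C z -> a <= g z].
Proof.
move=> lf fle d0 C0 Cd CK.
have main f' (d' : R) z0 : lin f' -> (forall z, f' z <= `|z|) -> 0 < d' ->
    (forall z, C z -> d' <= f' z) -> f0 z0 = 0 -> f' z0 != 0 ->
    exists y g (a : R), [/\ `|y| = 1, norm_frechet E y, supports E g y, 0 < a &
      forall z, C z -> a <= g z].
  move=> lf' fle' d'0 Cd' f0z f'z.
  have z0n0 : z0 != 0 by apply: contra_neq f'z => ->; rewrite lin0.
  have nz0 : 0 < `|z0| by rewrite normr_gt0.
  (* At [z0] the tolerance is half of [|f' z0|], so the approximant cannot vanish there, as [f0] and
     [- f0] do. *)
  pose e := `|f' z0| / 2 / `|z0|.
  have e0 : 0 < e by rewrite !divr_gt0// normr_gt0.
  have [y [g [a [c [y1 sg a0 Cg [c0 fg]]]]]] :=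
    support_near _ _ _ _ _ Ec e0 lf' fle' d'0 C0 Cd' CK.
  exists y, g, a; split=> //; have [//|gf0] := fr _ y1.
  have gz0 : g z0 = 0 by case: (gf0 _ sg) => ->; rewrite f0z ?oppr0.
  have := fg z0; rewrite gz0 mulr0 subr0 /e divfK ?gt_eqF//.
  have : 0 < `|f' z0| by rewrite normr_gt0.
  by move=> h1 h2; exfalso; lra.
have [[z0 [f0z fz]]|h] := pselect (exists z0, f0 z0 = 0 /\ f z0 != 0).
  exact: (main f d z0).
have [[z0 [f0z zn0]]|inj] := pselect (exists z0, f0 z0 = 0 /\ z0 != 0).
  have fz0 : f z0 = 0.
    by apply/eqP/negPn/negP => fz; apply: h; exists z0.
  have [k [lk kle kz]] := norming _ z0.
  have [c Cc] := C0.
  have dK : d <= K.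
    by have := Cd _ Cc; have := fle c; have := CK _ Cc => ? ? ?; lra.
  have K0 : 0 < K by lra.
  (* With [s * K = d / 2] the tilt [(s / 2) * k] lowers the values on [C] by at most [d / 4]; with
     [s <= 1] the mixture stays below the norm. *)
  pose s := d / (2 * K).
  have sK : s * K = d / 2 by rewrite /s; field; rewrite gt_eqF.
  have s0 : 0 < s by rewrite divr_gt0// mulr_gt0.
  have s1 : s <= 1 by rewrite ler_pdivrMr ?mulr_gt0//; lra.
  apply: (main (fun z => 2^-1 * f z + (s / 2) * k z) (d / 4) z0) => //.
  - exact: lin_comb.
  - move=> z; have := fle z; have := kle z => h1 h2.
    have : s * k z <= 1 * `|z|.
      by apply: le_trans (ler_wpM2r (normr_ge0 z) s1); rewrite ler_wpM2l// ltW.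
    by move=> h3; lra.
  - by rewrite divr_gt0.
  - move=> z Cz; have := lin_le_norm1 _ _ lk kle z; rewrite ler_norml => /andP[h1 _].
    have := Cd _ Cz; have := ler_wpM2l (ltW s0) h1.
    by have := ler_wpM2l (ltW s0) (CK _ Cz) => h2 h3 h4; lra.
  - rewrite fz0 mulr0 add0r kz mulf_neq0 ?normr_eq0//.
    by rewrite gt_eqF// divr_gt0.
(* Here [f0] is injective and [E] is a line, on which [|1 + b| + |1 - b| = 2] for [|b| < 1]. *)
have [y [g [a [c [y1 sg a0 Cg _]]]]] :=
  support_near _ _ _ _ _ Ec ltr01 lf fle d0 C0 Cd CK.
exists y, g, a; split=> //.
have f0y : f0 y != 0.
  apply/eqP => f0y; apply: inj; exists y; split=> //.
  by rewrite -normr_eq0 y1 oner_eq0.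
have line v : v = (f0 v / f0 y) *: y.
  apply/eqP; rewrite -subr_eq0; apply/negPn/negP => hn0; apply: inj.
  by exists (v - (f0 v / f0 y) *: y); rewrite linB// linZ// divfK// subrr.
move=> e e0; exists 1 => // v; rewrite (line v); move: (f0 v / f0 y) => b.
rewrite normrZ y1 mulr1 => h1.
have -> : y + b *: y = (1 + b) *: y by rewrite scalerDl scale1r.
have -> : y - b *: y = (1 - b) *: y by rewrite scalerBl scale1r.
rewrite !normrZ y1 !mulr1.
move: h1; rewrite ltr_norml => /andP[h1 h2].
have h0 : 0 <= e * `|b| by rewrite mulr_ge0// ltW.
have -> : `|1 + b| = 1 + b by rewrite ger0_norm//; lra.
have -> : `|1 - b| = 1 - b by rewrite ger0_norm//; lra.
lra.
Qed.

(* The ball is centred far away in the direction [y] of a Frechet point whose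
   support functional separates: [|t y - w| <= 2 t - |t y + w| + o(1)], and the
   support functional bounds [|t y + w|] from below. *)
Lemma ball_separation C x (K : R) : closed C -> C !=set0 ->
    (forall z, C z -> `|z| <= K) -> @convex_set R E C -> ~ C x ->
  exists c r, [/\ (0 : R) < r, forall z, C z -> `|c - z| <= r & ~ `|c - x| <= r].
Proof.
move=> Ccl [z0 Cz0] CK Cconv Cx.
have [r r0 hr] : exists2 r : R, 0 < r & forall z, C z -> r <= `|z - x|.
  have /nbhs_ballP[r /= r0 rC] : nbhs x (~` C).
    by apply: open_nbhs_nbhs; split=> //; exact: closed_openC.
  exists r => // z Cz; rewrite leNgt; apply/negP => zr.
  by apply: (rC z) => //; rewrite -ball_normE /= distrC.
(* After translation [x] becomes [0] and [C'] stays at distance [r] from it; this yields a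
   functional below the norm that is at least [r] on [C']. *)
pose C' := [set z | C (x + z)].
pose S (z : E) (a : R) := C' z /\ a = r.
have [||||f [lf fle fS]] := @mazur_orlicz _ _ (fun z : E => `|z|) S.
- exact: sublinear_norm.
- by exists (z0 - x), r; split; rewrite // /C' /= subrKC.
- move=> y z a b t [y1 ->] [z1 ->] /andP[t0 t1]; split.
    rewrite /C' /=.
    have -> : x + (t *: y + (1 - t) *: z) = t *: (x + y) + (1 - t) *: (x + z).
      by rewrite !scalerDr addrACA -scalerDl subrKC scale1r.
    have := Cconv (x + y) (x + z) (Itv01 t0 t1).
    by rewrite !inE => /(_ y1 z1).
  by rewrite -mulrDl subrKC mul1r.
- by move=> z a [z1 ->]; have := hr _ z1; rewrite addrAC subrr add0r.
have C'0 : C' !=set0 by exists (z0 - x); rewrite /C' /= subrKC.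
have C'd z : C' z -> r <= f z by move=> Cz; exact: fS.
have C'K z : C' z -> `|z| <= K + `|x|.
  move=> /CK h; have := ler_normB (x + z) x.
  by rewrite addrAC subrr add0r => h1; lra.
have [y [g [a [y1 yfr [lg gle gy] a0 Cg]]]] :=
  frechet_support _ _ _ _ lf fle r0 C'0 C'd C'K.
set K' := K + `|x| in C'K.
have K'0 : 0 < K'.
  have [w Cw] := C'0.
  by have := C'd _ Cw; have := fle w; have := C'K _ Cw => ? ? ?; lra.
have e0 : 0 < a / (2 * K') by rewrite divr_gt0// mulr_gt0.
have [d d0 hd] := yfr _ e0.
(* [t] is large enough for [w / t] to have norm below [d] for all [w] in [C'], and for [t - a / 2]
   to be positive. The Frechet error is at most [a / 2], so [|t y - w| <= 2 t - (t + a) + a / 2]. *)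
pose t := K' / d + a + 1.
have t0 : 0 < t by rewrite !addr_gt0// divr_gt0.
have tK : K' / t < d.
  rewrite ltr_pdivrMr// /t mulrDr mulrDr mulrCA divff ?gt_eqF// mulr1.
  by have := mulr_gt0 d0 a0 => h; lra.
have ta : a < t by rewrite /t; have := divr_gt0 K'0 d0 => h; lra.
exists (x + t *: y), (t - a / 2); split; first by lra.
- move=> z Cz; pose w := z - x.
  have C'w : C' w by rewrite /C' /w /= subrKC.
  have -> : x + t *: y - z = t *: y - w by rewrite /w opprB addrCA addrA.
  have tw : `|t^-1 *: w| <= K' / t.
    by rewrite normrZ gtr0_norm ?invr_gt0// mulrC ler_wpM2r ?invr_ge0 ?C'K// ltW.
  have := hd _ (le_lt_trans tw tK); rewrite y1 mulr1.
  rewrite -(ler_pM2l t0) => h.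
  have e1 : t * `|y + t^-1 *: w| = `|t *: y + w|.
    by rewrite -{1}(gtr0_norm t0) -normrZ scalerDr scalerA divff ?gt_eqF// scale1r.
  have e2 : t * `|y - t^-1 *: w| = `|t *: y - w|.
    by rewrite -{1}(gtr0_norm t0) -normrZ scalerBr scalerA divff ?gt_eqF// scale1r.
  move: h; rewrite mulrBr mulrDr e1 e2 => h.
  have h3 : t * (a / (2 * K') * `|t^-1 *: w|) <= a / 2.
    rewrite normrZ gtr0_norm ?invr_gt0//.
    have -> : t * (a / (2 * K') * (t^-1 * `|w|)) = a / (2 * K') * `|w|.
      by field; rewrite !gt_eqF.
    have -> : a / 2 = a / (2 * K') * K' by field; rewrite gt_eqF.
    by rewrite ler_wpM2l ?(ltW e0)// C'K.
  have := gle (t *: y + w); rewrite linD// linZ// gy.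
  by have := Cg _ C'w => h4 h5; lra.
- by rewrite addrAC subrr add0r normrZ y1 mulr1 gtr0_norm//; apply/negP; rewrite -ltNge; lra.
Qed.

Lemma mazur_intersection_property : (exists u : E, u != 0) -> MIP E.
Proof.
move=> [u un0] C Ccl Cbd Cconv; apply/seteqP; split.
  by move=> x Cx B [_]; apply.
move=> x xB; apply: contrapT => Cx.
have [K K0 CK] := pinfty_ex_gt0 Cbd.
suff [c [r [r0 Cr xr]]] : exists c r, [/\ (0 : R) < r,
    forall z, C z -> `|c - z| <= r & ~ `|c - x| <= r].
  apply: xr; have : closed_ball c r x.
    apply: xB; split; first by exists c, r.
    by move=> z Cz; rewrite closed_ballE//; exact: Cr.
  by rewrite closed_ballE.
have [C0|/set0P C0] := eqVneq C set0; last exact: (ball_separation C x K).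
(* For empty [C], a unit ball whose centre is at distance [2] from [x]. *)
exists (x + (2 / `|u|) *: u), 1; split=> //; first by move=> z; rewrite C0.
rewrite addrAC subrr add0r normrZ ger0_norm ?divr_ge0// divfK ?normr_eq0//.
by apply/negP; rewrite -ltNge; lra.
Qed.

End main.
End mazur_intersection.

(** * Duality maps and subspaces *)

Lemma opposite_increments {R : realType} (u v g g' f e m : R) :
  u <= 1 + g -> v <= 1 - g' -> g - f <= e / 2 * m -> - (e / 2 * m) <= g' - f ->
  u + v - 2 * 1 <= e * m.
Proof. by move=> h1 h2 h3 h4; lra. Qed.

Section duality.
Context {R : realType} (X : normedModType R).
Implicit Types (f g : X -> R) (F G : dual X) (x y z : X).

Lemma dual_lin F : lin F.
Proof. by have /asboolP[lF _] := dualP F; exact: lF. Qed.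

Lemma lin_dual f (M : R) : lin f -> (forall z, f z <= M * `|z|) ->
  exists F : dual X, forall z, F z = f z.
Proof.
move=> lf fle.
pose fl : {linear X -> R^o} := HB.pack (f : X -> R^o)
  (GRing.isLinear.Build _ _ _ _ _ (lf : linear (f : X -> R^o))).
have cf : continuous (f : X -> R^o).
  apply: (linear_bounded_continuous fl).1; apply/linear_boundedP.
  near=> r => z; apply: le_trans (lin_le_norm _ _ _ lf fle z) _.
  by rewrite ler_wpM2r.
have fP : (f : X -> R^o) \in @dual_pred R X by apply/asboolP; split.
by exists (Dual fP).
Unshelve. all: by end_near. Qed.

Lemma dual_norm_ge F z : `|F z| <= `|F| * `|z|.
Proof.
have [->|zn0] := eqVneq z 0; first by rewrite (lin0 _ (dual_lin F)) !normr0 mulr0.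
have nz : 0 < `|z| by rewrite normr_gt0.
rewrite -ler_pdivrMr//; have [M FM] := dual_bounded F.
have -> : `|F z| / `|z| = `|F (`|z|^-1 *: z)|.
  by rewrite (linZ _ _ _ (dual_lin F)) normrM normfV normr_id mulrC.
by apply: (sup_norm_ge FM); rewrite /= normfZV.
Qed.

Lemma dual_norm_le F (M : R) : 0 <= M -> (forall z, F z <= M * `|z|) -> `|F| <= M.
Proof.
move=> M0 FM; apply: sup_norm_le; first by exists 0; rewrite /= normr0.
move=> z /= z1; apply: le_trans (lin_le_norm _ _ _ (dual_lin F) FM z) _.
by rewrite -[leRHS]mulr1 ler_wpM2l.
Qed.

Lemma duality_mapP F x : `|x| = 1 -> duality_map x F <-> supports X F x.
Proof.
move=> x1; split=> [[F1 Fx]|[lF Fle Fx]]; split=> //.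
- exact: dual_lin.
- by move=> z; have := dual_norm_ge F z; rewrite F1 mul1r; apply: le_trans (ler_norm _).
- apply/le_anti/andP; split; first by apply: dual_norm_le => // z; rewrite mul1r.
  by have := dual_norm_ge F x; rewrite Fx x1 mulr1 normr1.
Qed.

Lemma supports_dual f x : `|x| = 1 -> supports X f x ->
  exists2 F, duality_map x F & forall z, F z = f z.
Proof.
move=> x1 [lf fle fx].
have [F Ff] : exists F : dual X, forall z, F z = f z.
  by apply: (lin_dual f 1) => // z; rewrite mul1r.
exists F => //; apply/duality_mapP => //; split.
- by move=> a u v; rewrite !Ff.
- by move=> z; rewrite Ff.
- by rewrite Ff.
Qed.

(** The support functionals at the normalized [x + h] and [x - h] are both close to the one at [x],
    so the first-order parts of the two increments cancel. *)
Lemma frechet_smooth_norm_frechet x : `|x| = 1 -> frechet_smooth_point x ->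
  norm_frechet X x.
Proof.
move=> x1 [F [DF Fcont]] e e0.
have e20 : 0 < e / 2 by rewrite divr_gt0.
have /nbhs_ballP[r /= r0 hr] := Fcont _ e20.
(* [1 / 2] keeps [x + h] away from [0]; [r / 4] suffices because the normalized point is within
   [2 |h|] of [x]. *)
pose d := Num.min (1 / 2) (r / 4).
have d0 : 0 < d by rewrite lt_min !divr_gt0.
have key h : `|h| < d -> exists G, `|G - F| < e / 2 /\ `|x + h| <= 1 + G h.
  rewrite lt_min => /andP[h1 h2].
  have n1 : 1 - `|h| <= `|x + h|.
    by rewrite lerBlDr -x1 -{1}(addrK h x) ler_normB.
  have n2 : `|x + h| <= 1 + `|h| by rewrite -x1 ler_normD.
  have n0 : 0 < `|x + h| by lra.
  have xh0 : x + h != 0 by rewrite -normr_gt0.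
  pose y := `|x + h|^-1 *: (x + h).
  have y1 : `|y| = 1 by rewrite /y normfZV.
  have [f sf] := supportsP _ _ y1.
  have [G DG Gf] := supports_dual _ _ y1 sf.
  exists G; split.
    apply: (hr y) => //; rewrite -ball_normE /=.
    have -> : x - y = (x - (x + h)) + ((x + h) - y) by rewrite subrKA.
    apply: le_lt_trans (ler_normD _ _) _.
    have -> : `|x - (x + h)| = `|h| by rewrite opprD addrA subrr add0r normrN.
    have -> : x + h - y = (1 - `|x + h|^-1) *: (x + h) by rewrite scalerBl scale1r.
    rewrite normrZ -[X in _ + _ * X](ger0_norm (ltW n0)) -normrM mulrBl mul1r mulVf ?gt_eqF//.
    have : `| `|x + h| - 1 | <= `|h| by rewrite ler_norml; lra.
    by move=> h3; lra.
  have [lG Gle _] := (duality_mapP G y y1).1 DG.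
  have Gxh : G (x + h) = `|x + h|.
    have [_ _ Gy] := (duality_mapP G y y1).1 DG.
    by move: Gy; rewrite /y (linZ _ _ _ lG) => Gy;
      rewrite -[LHS]mul1r -(mulfV (lt0r_neq0 n0)) -mulrA Gy mulr1.
  by rewrite -Gxh (linD _ _ _ lG) lerD2r -x1 Gle.
exists d => // h hd.
have [G [GF Gh]] := key h hd; have [] := key (- h); first by rewrite normrN.
move=> G' [G'F G'h].
have := dual_norm_ge (G - F) h; have := dual_norm_ge (G' - F) h.
rewrite -[(G - F) h]/(G h - F h) -[(G' - F) h]/(G' h - F h).
rewrite !ler_norml => /andP[a1 a2] /andP[a3 a4].
move: G'h; rewrite (linN _ _ (dual_lin G')) x1 => G'h.
have b1 := ler_wpM2r (normr_ge0 h) (ltW GF).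
have b2 := ler_wpM2r (normr_ge0 h) (ltW G'F).
apply: opposite_increments Gh G'h (le_trans a4 b1) (le_trans _ a1).
by rewrite lerN2.
Qed.

(** The exception is recorded by its functional, not by [x0]: a subspace may miss [x0], but [f0]
    restricts to every subspace. *)
Definition almost_frechet := exists f0, lin f0 /\ forall y, `|y| = 1 ->
  norm_frechet X y \/ forall g, supports X g y ->
    (forall z, g z = f0 z) \/ (forall z, g z = - f0 z).

Lemma seq_complete_subspace (Y : closed_subspace X) :
  seq_complete X -> seq_complete (subspace_space Y).
Proof.
move=> Xc u uc; have [l ul] := Xc (fun n => subspace_val (u n)) uc.
have lY : l \in subspace_pred Y.
  apply/mem_set; rewrite ((closure_id _).1 (@subspace_closed _ _ Y)) => B /nbhs_ballP[e /= e0 eB].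
  have [n0 /(_ n0 (leqnn _)) hn] := ul _ e0.
  exists (subspace_val (u n0)); split.
    by have := subspace_valP (u n0); rewrite /subspace_pred inE.
  by apply: eB; rewrite -ball_normE /= distrC.
by exists (SubspaceSpace lY).
Qed.

Lemma supports_extend (Y : closed_subspace X) (g : subspace_space Y -> R)
    (y : subspace_space Y) :
  supports (subspace_space Y) g y -> exists2 h, supports X h (subspace_val y) &
    forall w, h (subspace_val w) = g w.
Proof.
move=> [lg gle gy].
pose S (z : X) (a : R) := exists w : subspace_space Y, z = subspace_val w /\ a = g w.
have [||||h [lh hle hS]] := @mazur_orlicz _ _ (fun z : X => `|z|) S.
- exact: sublinear_norm.
- by exists (subspace_val y), (g y), y.
- move=> _ _ _ _ t [v [-> ->]] [w [-> ->]] _.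
  by exists (t *: v + (1 - t) *: w); rewrite (linD g)// !(linZ g).
- by move=> _ _ [w [-> ->]]; exact: gle.
have hg w : h (subspace_val w) = g w.
  apply/le_anti; rewrite hS ?andbT; last by exists w.
  rewrite -lerN2 -(linN g)// -(linN h)//; apply: hS.
  by exists (- w).
by exists h => //; split; rewrite // hg.
Qed.

(** The condition [norm_frechet] restricts to [Y]. At the other points a support functional on [Y]
    extends to one on [X], which is [f0] or [- f0]. *)
Lemma almost_frechet_hereditary_MIP : seq_complete X -> (exists u : X, u != 0) ->
  almost_frechet -> hereditary_MIP X.
Proof.
move=> Xc X0 [f0 [lf0 fr]]; split; first exact: mazur_intersection_property fr X0.
move=> Y Y0.
apply: (mazur_intersection_property (subspace_space Y)
  (fun y : subspace_space Y => f0 (subspace_val y))) => //.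
- by move=> a u v; exact: lf0.
- exact: seq_complete_subspace.
- move=> y y1; have [fy|gf] := fr _ y1.
    by left => e /fy[d d0 hd]; exists d => // h; exact: hd.
  right => g /supports_extend[h sh hg]; have [hf|hf] := gf _ sh.
    by left => z; rewrite -hg hf.
  by right => z; rewrite -hg hf.
Qed.

(** Smoothness leaves one support functional at [x0], and its negative is the only one at [- x0]. *)
Lemma smooth_almost_frechet x0 : smooth X -> unit_sphere X x0 ->
  non_frechet_set X = [set x0; - x0] -> almost_frechet.
Proof.
move=> sX x01 nf; have [F DF] := sX _ x01.
have x0F g : supports X g x0 -> forall z, g z = F z.
  move=> sg z; have [G + Gg] := supports_dual _ _ x01 sg.
  by rewrite DF => <-; rewrite Gg.
exists F; split=> [|y y1]; first exact: dual_lin.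
have [/(frechet_smooth_norm_frechet _ y1)|nfy] := pselect (frechet_smooth_point y).
  by left.
right => g [lg gle gy].
have : non_frechet_set X y by [].
rewrite nf => -[yx|yx]; [left|right] => z.
  by apply: x0F; split; rewrite // -yx.
have lg' : lin (fun z => -1 * g z + 0 * g z) by exact: lin_comb.
rewrite -(x0F (fun z => -1 * g z + 0 * g z)); first by ring.
split=> // [w|].
  by rewrite mul0r addr0 mulN1r -linN// -(normrN w).
by rewrite mul0r addr0 mulN1r -linN// -yx.
Qed.

End duality.

Lemma complete_seq_complete {R : realType} (X : completeNormedModType R) :
  seq_complete X.
Proof.
move=> u uc.
have /cauchy_cvg/cvg_ex[l ul] : cauchy (u @ \oo).
  apply/cauchyP => e e0; have [n0 hn] := uc _ e0; exists (u n0).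
  by exists n0 => // n /= n0n; rewrite -ball_normE /= distrC; exact: hn.
exists l => e e0; have /cvgrPdist_lt/(_ _ e0)[n0 _ hn] := ul.
by exists n0 => n n0n; rewrite distrC; exact: hn.
Qed.

Lemma seq_complete_renorm {R : realType} (X : normedModType R) (N : equiv_norm X) :
  seq_complete X -> seq_complete (renorm N).
Proof.
move=> Xc u uc; have [m [M [m0 M0 mM]]] := enorm_equiv N.
have [e e0|l ul] := Xc u.
  have [n0 hn] := uc _ (mulr_gt0 m0 e0); exists n0 => n /hn.
  by move=> h; rewrite -(ltr_pM2l m0); apply: le_lt_trans h; exact: (mM _).1.
exists l => e e0; have [n0 hn] := ul _ (divr_gt0 e0 M0).
exists n0 => n /hn; rewrite ltr_pdivlMr// mulrC; apply: le_lt_trans.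
exact: (mM _).2.
Qed.

Lemma two_point_hereditary_MIP {R : realType} (X : completeNormedModType R) (N : equiv_norm X) :
  smooth (renorm N) ->
  (exists x0 : renorm N, unit_sphere (renorm N) x0 /\
     non_frechet_set (renorm N) = [set x0; - x0]) ->
  hereditary_MIP (renorm N) /\ ~ frechet_smooth (renorm N).
Proof.
move=> sN [x0 [x01 nf]]; split; last first.
  move=> /(_ _ x01) fx0.
  have : non_frechet_set (renorm N) x0 by rewrite nf; left.
  by case.
apply: almost_frechet_hereditary_MIP.
- exact/seq_complete_renorm/complete_seq_complete.
- by exists x0; rewrite -normr_eq0 x01 oner_eq0.
- exact: smooth_almost_frechet nf.
Qed.

(** * Quadratic forms on the dual *)

Section quadratic_estimate.
Context {R : realType}.

(** The set [p ^+ 2 <= b * s] with [b, s >= 0] is a convex cone; the mixed term is bounded by the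
    arithmetic-geometric mean inequality. *)
Lemma midpoint_cauchy (b s b' s' p p' : R) : 0 <= b -> 0 <= s -> 0 <= b' ->
    0 <= s' -> 0 <= p -> 0 <= p' -> p ^+ 2 <= b * s -> p' ^+ 2 <= b' * s' ->
  ((p + p') / 2) ^+ 2 <= (b + b') / 2 * ((s + s') / 2).
Proof.
move=> b0 s0 b'0 s'0 p0 p'0 h h'.
have pp' : p * p' <= (b * s' + b' * s) / 2.
  rewrite -ler_sqr ?nnegrE ?mulr_ge0 ?divr_ge0 ?addr_ge0 ?mulr_ge0//.
  rewrite exprMn; apply: le_trans (ler_pM (sqr_ge0 _) (sqr_ge0 _) h h') _.
  have := sqr_ge0 (b * s' - b' * s) => hq; nra.
nra.
Qed.

(** For [F], [G] in the dual body, [b] and [s] are the factors [1 - F(x0)^2] and [2 - Q(F)], [beta]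
    and [sigma] their averages with those of [G], and [A], [Q], [P] are [a^2], [Q], [p^2] at the
    midpoint. Convexity leaves the surplus [k] there; if scaling by [1 + d] already leads out of the
    body, [k] is of order [d]. *)
Lemma midpoint_slack (b s beta sigma A Q P k d : R) : 0 < b -> 0 < s -> 0 < d ->
    d <= 1 -> d <= b / 6 -> d <= s / 12 ->
    b / 2 <= beta -> s / 2 <= sigma -> 0 <= A -> 0 <= Q -> 0 <= k ->
    beta <= 1 - A -> sigma + k <= 2 - Q -> P <= beta * sigma ->
    ((1 + d) ^+ 2 * A <= 1 -> (1 + d) ^+ 2 * Q <= 2 ->
     (1 - (1 + d) ^+ 2 * A) * (2 - (1 + d) ^+ 2 * Q) < (1 + d) ^+ 2 * P) ->
  k * b <= 36 * d.
Proof.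
move=> b0 s0 d0 d1 db ds hb hs A0 Q0 k0 hA hQ hP.
have t0 : 0 <= (1 + d) ^+ 2 by rewrite sqr_ge0.
have t1 : (1 + d) ^+ 2 <= 1 + 3 * d by nra.
set t := (1 + d) ^+ 2 in t0 t1 *.
have tA : t * A <= A + 3 * d by nra.
have tQ : t * Q <= Q + 6 * d by nra.
move=> /(_ ltac:(lra) ltac:(lra)) h.
have h1 : (beta - 3 * d) * (sigma + k - 6 * d) <= (1 - t * A) * (2 - t * Q).
  apply: ler_pM; lra.
have h2 : t * P <= (1 + 3 * d) * (beta * sigma).
  apply: le_trans (ler_wpM2l t0 hP) _; apply: ler_wpM2r => //.
  by rewrite mulr_ge0; lra.
have bs : beta * sigma <= 2.
  by have : beta * sigma <= 1 * 2 by [apply: ler_pM; lra]; rewrite mul1r.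
have h3 : beta * k <= 18 * d.
  have h4 : (beta - 3 * d) * (sigma + k - 6 * d) < (1 + 3 * d) * (beta * sigma).
    exact: le_lt_trans h1 (lt_le_trans h h2).
  have h5 : d * (beta * sigma) <= d * 2 by rewrite ler_wpM2l// ltW.
  have h6 : d * beta <= d * 1 by rewrite ler_wpM2l ?(ltW d0)//; lra.
  have h7 : d * (sigma + k) <= d * 2 by rewrite ler_wpM2l ?(ltW d0)//; lra.
  have h8 : 0 <= d * d by nra.
  lra.
have h9 : b / 2 * k <= beta * k by rewrite ler_wpM2r.
lra.
Qed.

End quadratic_estimate.

Section seminorm_family.
Context {R : realType} (X : normedModType R).
Variable A : nat -> set X.
Hypothesis A1 : forall i z, A i z -> `|z| <= 1.
Hypothesis A0 : forall i, A i !=set0.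
Implicit Types (F G : dual X) (z x : X).

Lemma dual_le F z : `|z| <= 1 -> `|F z| <= `|F|.
Proof.
move=> z1; apply: le_trans (dual_norm_ge _ F z) _.
by rewrite -[leRHS]mulr1 ler_wpM2l.
Qed.

Definition seminorm i F : R := sup_norm (A i) F.
Local Notation r := seminorm.

Lemma seminorm_ge i F z : A i z -> `|F z| <= r i F.
Proof. by move=> Az; apply: sup_norm_ge Az => y /A1; exact: dual_le. Qed.

Lemma seminorm_le i F (M : R) : (forall z, A i z -> `|F z| <= M) -> r i F <= M.
Proof. exact: sup_norm_le. Qed.

Lemma seminorm_ge0 i F : 0 <= r i F.
Proof. by have [z Az] := A0 i; apply: le_trans (seminorm_ge _ _ _ Az). Qed.

Lemma seminorm_le_norm i F : r i F <= `|F|.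
Proof. by apply: seminorm_le => z /A1; exact: dual_le. Qed.

Lemma seminormZ i (a : R) F : r i (a *: F) = `|a| * r i F.
Proof. by apply: sup_normZ => // z /A1; exact: dual_le. Qed.

Lemma seminormD i F G : r i (F + G) <= r i F + r i G.
Proof.
apply: seminorm_le => z Az; rewrite -[(F + G) z]/(F z + G z).
by rewrite (le_trans (ler_normD _ _))// lerD// seminorm_ge.
Qed.

Definition mid F G : dual X := (2^-1 : R) *: (F + G).

Lemma midE F G z : mid F G z = (F z + G z) / 2.
Proof. by rewrite -[LHS]/(2^-1 * (F z + G z)) mulrC. Qed.

Lemma seminorm_mid i F G : r i (mid F G) <= (r i F + r i G) / 2.
Proof.
by rewrite seminormZ ger0_norm// mulrC ler_wpM2r// seminormD.
Qed.

Definition weight i : R := 2^-1 ^+ i.+1.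

Lemma weight_gt0 i : 0 < weight i. Proof. by rewrite exprn_gt0. Qed.

(** The midpoint convexity defect of the squared seminorm. *)
Definition slack i F G : R :=
  (r i F ^+ 2 + r i G ^+ 2) / 2 - r i (mid F G) ^+ 2.

Lemma slack_ge i F G : ((r i F - r i G) / 2) ^+ 2 <= slack i F G.
Proof.
have := seminorm_mid i F G; have := seminorm_ge0 i (mid F G).
rewrite /slack => h1 h2.
have : r i (mid F G) ^+ 2 <= ((r i F + r i G) / 2) ^+ 2.
  by rewrite ler_sqr ?nnegrE// divr_ge0// addr_ge0// seminorm_ge0.
by move=> h; nra.
Qed.

Lemma slack_ge0 i F G : 0 <= slack i F G.
Proof. exact: le_trans (sqr_ge0 _) (slack_ge i F G). Qed.

Definition partialQ n F : R := \sum_(i < n) weight i * r i F ^+ 2.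

Lemma sum_weight n : \sum_(i < n) weight i <= 1.
Proof.
suff -> : \sum_(i < n) weight i = 1 - 2^-1 ^+ n by rewrite gerBl exprn_ge0.
elim: n => [|n IH]; first by rewrite big_ord0 expr0 subrr.
by rewrite big_ord_recr/= IH /weight exprS; lra.
Qed.

Lemma partialQ_le n F : partialQ n F <= `|F| ^+ 2.
Proof.
apply: (@le_trans _ _ (\sum_(i < n) weight i * `|F| ^+ 2)).
  apply: ler_sum => i _; rewrite ler_wpM2l ?(ltW (weight_gt0 i))//.
  by rewrite ler_sqr ?nnegrE ?seminorm_ge0// seminorm_le_norm.
by rewrite -mulr_suml -[leRHS]mul1r ler_wpM2r ?sqr_ge0// sum_weight.
Qed.

(** The sum of the weighted series, taken as a supremum so that semicontinuity can be checked on
    finite sums. *)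
Definition Q F : R := sup (range (partialQ^~ F)).

Lemma Q_ge n F : partialQ n F <= Q F.
Proof.
apply: ub_le_sup; last by exists n.
by exists (`|F| ^+ 2) => _ [m _ <-]; exact: partialQ_le.
Qed.

Lemma Q_le F (M : R) : (forall n, partialQ n F <= M) -> Q F <= M.
Proof.
move=> FM; apply: ge_sup; first by exists (partialQ 0 F), 0.
by move=> _ [m _ <-].
Qed.

Lemma Q_ge0 F : 0 <= Q F.
Proof. by apply: le_trans (Q_ge 0 F); rewrite /partialQ big_ord0. Qed.

Lemma Q_le_norm F : Q F <= `|F| ^+ 2.
Proof. by apply: Q_le => n; exact: partialQ_le. Qed.

Lemma QZ (a : R) F : Q (a *: F) <= a ^+ 2 * Q F.
Proof.
apply: Q_le => n; apply: le_trans (ler_wpM2l (sqr_ge0 a) (Q_ge n F)).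
rewrite /partialQ mulr_sumr; apply: ler_sum => i _.
by rewrite seminormZ exprMn real_normK ?num_real// mulrCA.
Qed.

(** All slacks are nonnegative, so the one of index [i] can be kept and the others dropped. *)
Lemma Q_mid i F G : Q (mid F G) + weight i * slack i F G <= (Q F + Q G) / 2.
Proof.
have sl j : weight j * r j (mid F G) ^+ 2 <=
    (weight j * r j F ^+ 2 + weight j * r j G ^+ 2) / 2.
  have := ler_wpM2l (ltW (weight_gt0 j)) (slack_ge0 j F G); rewrite /slack mulr0.
  by move=> h; lra.
rewrite -lerBrDr; apply: Q_le => n; rewrite lerBrDr.
pose m := (maxn n i.+1).
have im : (i < m)%N by rewrite leq_maxr.
apply: (@le_trans _ _ ((partialQ m F + partialQ m G) / 2)); last first.
  by have := Q_ge m F; have := Q_ge m G => h1 h2; lra.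
apply: (@le_trans _ _ (partialQ m (mid F G) + weight i * slack i F G)).
  rewrite lerD2r; have <- : (n + (m - n) = m)%N by rewrite subnKC// leq_maxl.
  rewrite /partialQ big_split_ord/= lerDl.
  by apply: sumr_ge0 => j _; rewrite mulr_ge0 ?(ltW (weight_gt0 _))// sqr_ge0.
rewrite /partialQ -big_split/= mulr_suml (bigD1 (Ordinal im))//=.
rewrite [leRHS](bigD1 (Ordinal im))//= -addrAC; apply: lerD.
  by rewrite /slack; lra.
by apply: ler_sum => j _; exact: sl.
Qed.

End seminorm_family.

(** * The dual unit ball and its norm *)

Lemma ultra_cvg_compact {T : Type} {V : topologicalType} {W : set_system T}
    {f : T -> V} {K : set V} : UltraFilter W -> compact K -> W (f @^-1` K) ->
  exists l : V, f @ W --> l.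
Proof.
move=> WU cK WK; have [l [_ cl]] := cK (f @ W) _ WK; exists l => B Bl.
have [//|WB] := in_ultra_setVsetC (f @^-1` B) WU.
by have [y []] := cl (~` B) B WB Bl.
Qed.

Section dual_body.
Context {R : realType} (X : normedModType R).
Variables (A : nat -> set X) (Z : set X) (x0 : X).
Hypotheses (A1 : forall i z, A i z -> `|z| <= 1) (A0 : forall i, A i !=set0).
Hypothesis Aball : forall z, `|z| <= 1 -> A 0 z.
Hypotheses (Z1 : forall z, Z z -> `|z| <= 1) (Z0 : Z !=set0).
Implicit Types (F G H : dual X) (x y z : X).

Local Notation r := (seminorm X A).
Local Notation p := (seminorm X (fun=> Z) 0).
Local Notation Q := (Q X A).
Local Notation mid := (mid X).

Let p_ge F z : Z z -> `|F z| <= p F.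
Proof. exact: (seminorm_ge X (fun=> Z) (fun=> Z1)). Qed.

Let p_ge0 F : 0 <= p F.
Proof. exact: (seminorm_ge0 X (fun=> Z) (fun=> Z1) (fun=> Z0)). Qed.

(* The sublevel set [a^2 + p^2 / (2 - Q) <= 1], [a = F x0], with the division
   cleared so that no case distinction is needed at [Q = 2]. *)
Definition dual_body F := [/\ F x0 ^+ 2 <= 1, Q F <= 2 &
  p F ^+ 2 <= (1 - F x0 ^+ 2) * (2 - Q F)].

(** [A 0] contains the unit ball and has weight [1 / 2], so [|F|^2 / 2 <= Q F <= 2]. *)
Lemma dual_body_norm F : dual_body F -> `|F| <= 2.
Proof.
move=> [_ QF _].
have : partialQ X A 1 F <= 2 by apply: le_trans (Q_ge X A A1 A0 1 F) QF.
rewrite /partialQ big_ord1 /weight expr1 => h.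
have r2 : r 0 F <= 2.
  rewrite -ler_sqr ?nnegrE ?(seminorm_ge0 X A A1 A0)//.
  rewrite (_ : (2 : R) ^+ 2 = 4); last by rewrite expr2; lra.
  by move: h; rewrite /=; lra.
apply: sup_norm_le; first by exists 0; rewrite /= normr0.
by move=> z z1; apply: le_trans r2; apply: (seminorm_ge X A A1); exact: Aball.
Qed.

Lemma dual_body_le F x : dual_body F -> `|F x| <= 2 * `|x|.
Proof.
move=> /dual_body_norm F2; apply: le_trans (dual_norm_ge _ F x) _.
by rewrite ler_wpM2r.
Qed.

Lemma dual_bodyN F : dual_body F -> dual_body (- F).
Proof.
move=> [Fx QF pF]; have e : - F = (-1 : R) *: F by rewrite scaleN1r.
have ex : (- F) x0 = - F x0 by [].
have QN : Q (- F) <= Q F.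
  by rewrite e (le_trans (QZ X A A1 A0 _ _))// sqrrN expr1n mul1r.
have pN : p (- F) = p F.
  by rewrite e (seminormZ X (fun=> Z) (fun=> Z1) (fun=> Z0)) normrN1 mul1r.
split; rewrite ?ex ?sqrrN ?pN//; first exact: le_trans QN QF.
by apply: le_trans pF _; rewrite ler_wpM2l ?subr_ge0// lerD2l lerN2.
Qed.

(* Weak* compactness, in the only form that is needed. *)
Lemma dual_body_cluster (g : nat -> dual X) : (forall k, dual_body (g k)) ->
  exists2 F, dual_body F &
    forall x c, (exists n0, forall k, (n0 <= k)%N -> c <= g k x) -> c <= F x.
Proof.
move=> Ug.
(* Along an ultrafilter finer than the tails every bounded sequence [g k x] converges; the limits
   define [F]. *)
have [W [WU Wsub]] := ultraFilterLemma (eventually_filter : ProperFilter \oo).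
have WP : ProperFilter W by exact: ultra_proper.
have Lx x : exists l : R^o, (g k x : R^o) @[k --> W] --> l.
  apply: (ultra_cvg_compact WU (@segment_compact R (- (2 * `|x|)) (2 * `|x|))).
  by apply: filterE => k; rewrite /= in_itv /= -ler_norml; exact: dual_body_le.
have [L gL] := choice Lx.
have lL : lin L.
  move=> a u v; have h : (g k (a *: u + v) : R^o) @[k --> W] --> (a * L u + L v : R^o).
    under eq_cvg do rewrite (dual_lin _ (g _)).
    by apply: cvgD => //; apply: cvgM => //; exact: cvg_cst.
  exact: cvg_unique (gL _) h.
have Lge x c : (\forall k \near W, c <= g k x) -> c <= L x.
  by move=> h; exact: cvgr_to_ge (gL x) h.
have Lle x : L x <= 2 * `|x|.
  apply: (cvgr_to_le (gL x)); apply: filterE => k.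
  exact: le_trans (ler_norm _) (dual_body_le _ _ _).
have [F FL] := lin_dual _ _ _ lL Lle.
have gF x : (g k x : R^o) @[k --> W] --> (F x : R^o) by rewrite FL.
(* Suprema of evaluations are lower semicontinuous for pointwise convergence, and so are the finite
   sums [partialQ]. *)
have lsc_r i d : 0 < d -> \forall k \near W, r i F - d <= r i (g k).
  move=> d0; have [z Az hz] : exists2 z, A i z & r i F - d < `|F z|.
    have := @sup_adherent _ [set `|F z| | z in A i] _ d0.
    case.
      split; first by have [z Az] := A0 i; exists `|F z|, z.
      by exists `|F| => _ [z Az <-]; apply: dual_le; exact: A1 Az.
    by move=> _ [z Az <-] hz; exists z.
  have := cvgr_norm_gt (F z) (gF z) _ hz => /(_ _)-h0; apply: filterS h0 => k hk.
  by apply: le_trans (ltW hk) _; exact: (seminorm_ge X A A1).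
have lsc n d : 0 < d ->
    \forall k \near W, partialQ X A n F - d <= partialQ X A n (g k).
  elim: n d => [|n IH] d d0.
    by apply: filterE => k; rewrite /partialQ !big_ord0; lra.
  have d20 : 0 < d / 2 by rewrite divr_gt0.
  have rF := seminorm_ge0 X A A1 A0 n F.
  pose w := weight n : R.
  have w0 : 0 < w := weight_gt0 n.
  (* This makes the loss [2 * w * t * r n F] at most [d / 2]. *)
  pose t := d / 2 / (2 * w * r n F + 1).
  have den : 0 < 2 * w * r n F + 1.
    by rewrite ltr_wpDl// !mulr_ge0// ltW.
  have t0 : 0 < t by rewrite divr_gt0.
  have ht : t * (2 * w * r n F) <= d / 2.
    rewrite /t mulrAC ler_pdivrMr// ler_wpM2l ?(ltW d20)//; lra.
  move: (IH _ d20) (lsc_r n _ t0); apply: filterS2 => k h1 h2.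
  rewrite /partialQ !big_ord_recr/= -/(partialQ X A n F) -/(partialQ X A n (g k)) -/w.
  have rg := seminorm_ge0 X A A1 A0 n (g k).
  have h3 : r n F ^+ 2 - 2 * t * r n F <= r n (g k) ^+ 2.
    have [h|h] := leP t (r n F).
      have : (r n F - t) ^+ 2 <= r n (g k) ^+ 2.
        by rewrite ler_sqr ?nnegrE ?subr_ge0.
      by have := sqr_ge0 t => h4 h5; nra.
    by have := sqr_ge0 (r n (g k)) => h4; nra.
  by have := ler_wpM2l (ltW w0) h3 => h4; lra.
have sq x : (g k x ^+ 2 : R^o) @[k --> W] --> (F x ^+ 2 : R^o).
  by under eq_cvg do rewrite expr2; rewrite expr2; apply: cvgM.
have Fx1 : F x0 ^+ 2 <= 1.
  by apply: (cvgr_to_le (sq x0)); apply: filterE => k; have [] := Ug k.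
have QF : Q F <= 2.
  apply: (Q_le X A) => n; apply/ler_addgt0Pr => d d0; rewrite -lerBlDr.
  have /filter_ex[k hk] := lsc n _ d0.
  by have [_ Qk _] := Ug k; apply: le_trans hk (le_trans (Q_ge X A A1 A0 n _) Qk).
exists F; last first.
  move=> x c [n0 hn]; rewrite FL; apply: Lge; apply: Wsub.
  by exists n0 => // k /= /hn.
split=> //.
(* [p] is tested at one point and [Q] on one partial sum, so that convergence and [lsc] suffice; the
   suprema are taken afterwards. *)
have key n z : Z z -> F z ^+ 2 <= (1 - F x0 ^+ 2) * (2 - partialQ X A n F).
  move=> Zz; apply/ler_addgt0Pr => d d0.
  have h1 : ((1 - g k x0 ^+ 2) * (2 - partialQ X A n F + d) : R^o) @[k --> W] -->
      ((1 - F x0 ^+ 2) * (2 - partialQ X A n F + d) : R^o).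
    by apply: cvgM; [apply: cvgB => //|]; exact: cvg_cst.
  have h2 : F z ^+ 2 <= (1 - F x0 ^+ 2) * (2 - partialQ X A n F + d).
    apply: (ler_cvg_to (sq z) h1); have := lsc n _ d0; apply: filterS => k hk.
    have [a1 _ pk] := Ug k.
    have gz : g k z ^+ 2 <= p (g k) ^+ 2.
      rewrite -[leLHS]real_normK ?num_real// ler_sqr ?nnegrE//; exact: p_ge.
    apply: le_trans gz (le_trans pk _); rewrite ler_wpM2l ?subr_ge0//.
    by have := Q_ge X A A1 A0 n (g k) => h; lra.
  apply: le_trans h2 _; rewrite mulrDr lerD2l -[leRHS]mul1r ler_wpM2r ?(ltW d0)//.
  by have := sqr_ge0 (F x0) => h; lra.
have pF n : p F ^+ 2 <= (1 - F x0 ^+ 2) * (2 - partialQ X A n F).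
  have rhs0 : 0 <= (1 - F x0 ^+ 2) * (2 - partialQ X A n F).
    by have [z Zz] := Z0; apply: le_trans (key n z Zz); exact: sqr_ge0.
  rewrite -[leRHS]sqr_sqrtr// ler_sqr ?nnegrE// ?sqrtr_ge0//.
  apply: seminorm_le => // z Zz; rewrite -sqrtr_sqr ler_wsqrtr//.
  exact: key.
(* The supremum over [n] is taken after dividing by the first factor; if that factor is [0], the
   bound at [n = 0] is already the claim. *)
have [e|ne] := eqVneq (1 - F x0 ^+ 2) 0.
  by have := pF 0; rewrite e !mul0r.
have b0 : 0 < 1 - F x0 ^+ 2 by rewrite lt_def ne subr_ge0.
rewrite mulrC -ler_pdivrMr// lerBrDl -lerBrDr; apply: (Q_le X A) => n.
by rewrite lerBrDr -lerBrDl ler_pdivrMr// mulrC.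
Qed.

End dual_body.

(** * Scalar inequalities for the renorming *)

Lemma norm_le1_mul1 {R : realType} (c d : R) : `|c| <= 1 -> `|d| <= 1 ->
  c * d = 1 -> c ^+ 2 = 1.
Proof.
rewrite !ler_norml => /andP[c1 c2] /andP[d1 d2] cd; rewrite expr2.
have cc : 0 <= (1 - c) * (1 + c) by rewrite mulr_ge0//; lra.
have dd : 0 <= (1 - d) * (1 + d) by rewrite mulr_ge0//; lra.
have cd2 := sqr_ge0 (c - d).
by apply/le_anti/andP; split; lra.
Qed.

(** The product is [1 + t v + O(t^2)], so [v > 0] would push it above [1] for small [t]. *)
Lemma flat_at_maximum {R : realType} (K n v : R) : 0 <= n -> 0 < K ->
    (forall t, 0 < t -> t * n <= 1 / 8 -> K * t ^+ 2 <= 1 / 2 ->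
      (1 - K * t ^+ 2) * (1 + t * v) <= 1) ->
  v <= 0.
Proof.
move=> n0 K0 small; apply/ler_addgt0Pr => e e0; rewrite add0r.
have [t [t0 tn tK te t1]] : exists t : R, [/\ 0 < t, t * (8 * (n + 1)) <= 1,
    t * (2 * K) <= 1, t * (4 * K) <= e & t <= 1].
  have n10 : 0 < n + 1 by rewrite ltr_wpDl.
  exists (Num.min (1 / (8 * (n + 1)))
    (Num.min (1 / (2 * K)) (Num.min (e / (4 * K)) 1))).
  rewrite -!ler_pdivlMr ?mulr_gt0// !ge_min !lexx !orbT.
  by split=> //; rewrite !lt_min !divr_gt0// ?mulr_gt0// ltr01.
have Kt2 : K * t ^+ 2 <= K * t by rewrite ler_pM2l// expr2 ler_piMr// ltW.
have := small t t0 ltac:(lra) ltac:(lra) => h {small}.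
rewrite leNgt; apply/negP => ev.
have h1 : (1 - K * t ^+ 2) * (1 + t * e) < (1 - K * t ^+ 2) * (1 + t * v).
  by rewrite ltr_pM2l ?ltrD2l ?ltr_pM2l//; lra.
have te0 : 0 < t * e by rewrite mulr_gt0.
have h3 : K * t ^+ 2 * (t * e) <= 1 / 2 * (t * e).
  by rewrite ler_wpM2r ?(ltW te0)//; lra.
have h4 : t * (t * (4 * K)) <= t * e by rewrite ler_pM2l.
have h5 : 0 < K * t ^+ 2 by rewrite mulr_gt0// exprn_gt0.
by rewrite expr2 in h h1 h3 h5; lra.
Qed.

(** Here [a = f0 u] and [b = G u]. The perturbation gains [t b / 8 >= t / 16], shrinking by [1 - e]
    costs at most [17 e / 8], and the tolerance is only [t / 32]. *)
Lemma kink_estimate {R : realType} (e t a b : R) : 0 < t -> t <= 1 ->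
  e * 200 = t -> 1 / 2 <= b -> b <= 1 -> a <= 1 ->
  (1 - e) * (1 + 1 / 8 * 0) + t * ((1 - e) * (a + 1 / 8 * b)) + (1 - t * a) - 2
    <= 1 / 64 * (2 * t) -> False.
Proof.
move=> t0 t1 et b1 b2 a1.
have e0 : 0 < e by lra.
have te0 : 0 < t * e by rewrite mulr_gt0.
have h1 : t * e * (a + 1 / 8 * b) <= t * e * (9 / 8) by rewrite ler_pM2l//; lra.
have h2 : t * e <= e by rewrite ler_piMl// ltW.
have h3 : t * (1 / 2) <= t * b by rewrite ler_pM2l.
lra.
Qed.

Lemma midpoint_sqr_le {R : realType} (a b : R) :
  (1 - a ^+ 2 + (1 - b ^+ 2)) / 2 <= 1 - ((a + b) / 2) ^+ 2.
Proof. by have := sqr_ge0 (a - b) => h; lra. Qed.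

Lemma midpoint_sub_le {R : realType} (q a b k : R) : q + k <= (a + b) / 2 ->
  (2 - a + (2 - b)) / 2 + k <= 2 - q.
Proof. by move=> h; lra. Qed.

Lemma scaled_midpoint_gt1 {R : realType} (d g : R) : 0 < d -> d <= 1 ->
  1 - d < g -> 1 < (1 + d) * ((1 + g) / 2).
Proof. by move=> d0 d1 hg; nra. Qed.

(** * The norm defined by the dual body *)

Section gauge.
Context {R : realType} (X : normedModType R).
Variables (A : nat -> set X) (Z : set X) (x0 : X) (f0 : dual X).
Hypotheses (A1 : forall i z, A i z -> `|z| <= 1) (A0 : forall i, A i !=set0).
Hypothesis Aball : forall z, `|z| <= 1 -> A 0 z.
Hypotheses (Z1 : forall z, Z z -> `|z| <= 1) (Z0 : Z !=set0).
Hypotheses (f01 : `|f0| <= 1) (f0x0 : f0 x0 = 1).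
Implicit Types (F G H : dual X) (x y z : X).

Local Notation r := (seminorm X A).
Local Notation p := (seminorm X (fun=> Z) 0).
Local Notation Q := (Q X A).
Local Notation mid := (mid X).
Local Notation U := (dual_body X A Z x0).

Hypothesis x01 : `|x0| <= 1.
Hypothesis pf0 : p f0 = 0.
Hypothesis psep : forall F, p F = 0 -> F = F x0 *: f0.
(** The source of local uniform rotundity: a seminorm that is small at [F] and, with finitely many
    evaluations, controls the norm. *)
Hypothesis net : forall F (e : R), 0 < e -> exists i (J : seq nat),
  [/\ r i F <= e, forall j, j \in J -> exists y, A j = [set y] &
    forall H c, 0 <= c -> (forall j, j \in J -> r j H <= c) ->
      `|H| <= 2 * r i H + c].
(** Directions in which [f0] can be perturbed almost for free; they destroy Frechet smoothness at
    [x0]. *)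
Hypothesis weak_null : forall e : R, 0 < e -> exists G u,
  [/\ G x0 = 0, `|G| <= 1, `|u| <= 1, 1 / 2 <= G u & p G <= e].

Let p_ge0 F : 0 <= p F.
Proof. exact: (seminorm_ge0 X (fun=> Z) (fun=> Z1) (fun=> Z0)). Qed.

Let p_le F : p F <= `|F|.
Proof. exact: (seminorm_le_norm X (fun=> Z) (fun=> Z1) (fun=> Z0)). Qed.

Let pZ (a : R) F : p (a *: F) = `|a| * p F.
Proof. exact: (seminormZ X (fun=> Z) (fun=> Z1) (fun=> Z0)). Qed.

Let pD F G : p (F + G) <= p F + p G.
Proof. exact: (seminormD X (fun=> Z) (fun=> Z1) (fun=> Z0)). Qed.

Let QF_le F : Q F <= `|F| ^+ 2.
Proof. exact: Q_le_norm X A A1 A0 F. Qed.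

Let U_f0 : U f0.
Proof.
split; first by rewrite f0x0 expr1n.
  apply: le_trans (QF_le _) _; apply: (@le_trans _ _ (1 ^+ 2)); last by rewrite expr1n; lra.
  by rewrite ler_sqr ?nnegrE.
by rewrite pf0 f0x0 expr1n subrr mul0r expr0n.
Qed.

Lemma dual_body_half F : `|F| <= 1 / 2 -> U F.
Proof.
move=> F2.
have n0 := normr_ge0 F.
have F4 : `|F| ^+ 2 <= 1 / 4.
  rewrite (_ : 1 / 4 = (1 / 2) ^+ 2); first by rewrite ler_sqr ?nnegrE.
  by rewrite expr2; lra.
have Fx : F x0 ^+ 2 <= 1 / 4.
  apply: le_trans F4; rewrite -[leLHS]real_normK ?num_real// ler_sqr ?nnegrE//.
  exact: dual_le.
have QF : Q F <= 1 / 4 by apply: le_trans (QF_le _) F4.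
have pF : p F ^+ 2 <= 1 / 4.
  by apply: le_trans F4; rewrite ler_sqr ?nnegrE.
split; [lra|lra|apply: le_trans pF _].
apply: (@le_trans _ _ (3 / 4 * (7 / 4))); first by lra.
by apply: ler_pM; lra.
Qed.

(** The support function of [U], that is, the gauge of its polar. *)
Definition gauge x : R := sup [set F x | F in U].

Lemma gauge_ge F x : U F -> F x <= gauge x.
Proof.
move=> UF; apply: ub_le_sup; last by exists F.
exists (2 * `|x|) => _ [G UG <-]; apply: le_trans (ler_norm _) _.
exact: dual_body_le UG.
Qed.

(** A cluster point of a maximizing sequence attains the supremum. *)
Lemma gauge_attained x : exists2 F, U F & F x = gauge x.
Proof.
have hs : has_sup [set F x | F in U].
  split; first by exists (f0 x), f0.
  exists (2 * `|x|) => _ [G UG <-]; apply: le_trans (ler_norm _) _.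
  exact: dual_body_le UG.
have /choice[g gP] k : exists F, U F /\ gauge x - k.+1%:R^-1 < F x.
  have k0 : (0 : R) < k.+1%:R^-1 by rewrite invr_gt0.
  by have [_ [F UF <-] h] := sup_adherent k0 hs; exists F.
have [F UF hF] := dual_body_cluster X A Z x0 A1 A0 Aball Z1 Z0 g (fun k => (gP k).1).
exists F => //; apply/le_anti; rewrite gauge_ge//=.
apply/ler_addgt0Pr => e e0; rewrite -lerBlDr; apply: hF.
have [n0 _ hn] := near_infty_natSinv_lt (PosNum e0).
exists n0 => k n0k; apply: le_trans (ltW (gP k).2).
by rewrite lerD2l lerN2; exact: ltW (hn _ n0k).
Qed.

Lemma gauge_le x : gauge x <= 2 * `|x|.
Proof.
have [F UF <-] := gauge_attained x; apply: le_trans (ler_norm _) _.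
exact: dual_body_le UF.
Qed.

Lemma gaugeD x y : gauge (x + y) <= gauge x + gauge y.
Proof.
have [F UF <-] := gauge_attained (x + y).
by rewrite (linD F)//; [apply: lerD; exact: gauge_ge|exact: dual_lin].
Qed.

Lemma gaugeZ (a : R) x : gauge (a *: x) = `|a| * gauge x.
Proof.
have key (b : R) y : gauge (b *: y) <= `|b| * gauge y.
  have [F UF <-] := gauge_attained (b *: y); rewrite (linZ F); last exact: dual_lin.
  have [b0|b0] := ger0P b.
    by rewrite ler_wpM2l// gauge_ge.
  rewrite -mulrNN; rewrite ler_wpM2l ?oppr_ge0 ?(ltW b0)//.
  by apply: (gauge_ge (- F)); apply: dual_bodyN.
apply/le_anti; rewrite key/=.
have [->|a0] := eqVneq a 0.
  have [F UF <-] := gauge_attained (0 *: x).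
  by rewrite scale0r normr0 mul0r (lin0 F)//; exact: dual_lin.
have := key a^-1 (a *: x); rewrite scalerA mulVf// scale1r.
by rewrite normfV mulrC ler_pdivlMr ?normr_gt0// mulrC.
Qed.

(** For the lower bound, half of a norming functional lies in the body. *)
Lemma gauge_equiv : exists m M : R, [/\ 0 < m, 0 < M &
  forall x, m * `|x| <= gauge x /\ gauge x <= M * `|x|].
Proof.
exists (1 / 2), 2; split=> // x; split; last exact: gauge_le.
have [f [lf fle fx]] := norming X x.
have [F Ff] : exists F : dual X, forall z, F z = f z.
  by apply: (lin_dual X f 1) => // z; rewrite mul1r.
have F1 : `|F| <= 1 by apply: dual_norm_le => // z; rewrite Ff mul1r.
have : U ((1 / 2 : R) *: F).
  by apply: dual_body_half; rewrite normrZ ger0_norm//; lra.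
by move=> /(gauge_ge _ x); rewrite -[((1 / 2 : R) *: F) x]/(1 / 2 * F x) Ff fx.
Qed.

Definition gauge_norm : equiv_norm X := EquivNorm gaugeD gaugeZ gauge_equiv.

Lemma dual_body_eq_f0 F : U F -> F x0 = 1 -> F = f0.
Proof.
move=> [_ _ +] F1; rewrite F1 expr1n subrr mul0r => h.
have pF : p F = 0.
  by apply/eqP; rewrite -sqrf_eq0; apply/eqP/le_anti; rewrite h sqr_ge0.
by rewrite (psep F pF) F1 scale1r.
Qed.

Lemma gauge_x0 : gauge x0 = 1.
Proof.
apply/le_anti/andP; split; last by rewrite -f0x0; exact: gauge_ge.
have [F [+ _ _] <-] := gauge_attained x0.
by rewrite -[leLHS]real_normK ?num_real// expr_le1// => h; exact: le_trans (ler_norm _) h.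
Qed.

(** Since [p F > 0], both factors are positive at [F]. At [x] the midpoint of [F] and [G] exceeds
    [1 / (1 + d)], so scaling by [1 + d] takes it out of the body and [midpoint_slack] applies. *)
Lemma slack_small F x : U F -> F x = 1 -> gauge x = 1 -> 0 < p F ->
  forall i (e : R), 0 < e -> exists2 d, 0 < d &
    forall G, U G -> 1 - d < G x -> slack X A i F G <= e.
Proof.
move=> UF Fx Nx pF i e e0.
have [a1 q2 pq] := UF.
have pq0 : 0 < (1 - F x0 ^+ 2) * (2 - Q F) by apply: lt_le_trans pq; rewrite exprn_gt0.
have b0 : 0 < 1 - F x0 ^+ 2.
  rewrite lt_def subr_ge0 a1 andbT; apply/eqP => h.
  by move: pq0; rewrite h mul0r ltxx.
have s0 : 0 < 2 - Q F.
  rewrite lt_def subr_ge0 q2 andbT; apply/eqP => h.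
  by move: pq0; rewrite h mulr0 ltxx.
set b := 1 - F x0 ^+ 2 in b0 pq; set s := 2 - Q F in s0 pq.
have w0 := weight_gt0 i : 0 < (weight i : R).
set w := weight i in w0.
(* The first three bounds are those of [midpoint_slack]; the last turns [w * k * b <= 36 * d] into
   [k <= e]. *)
pose d := Num.min (Num.min 1 (b / 6)) (Num.min (s / 12) (e * w * b / 36)).
have ewb0 : 0 < e * w * b by rewrite !mulr_gt0.
have d0 : 0 < d by rewrite !lt_min ltr01 !divr_gt0.
have [d1 d2 d3 d4] : [/\ d <= 1, d <= b / 6, d <= s / 12 & d <= e * w * b / 36].
  by split; rewrite /d !ge_min lexx ?orbT.
exists d => // G UG Gx; have [a1' q2' pq'] := UG.
set k := slack X A i F G.
have k0 : 0 <= k by exact: slack_ge0.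
have Mx0 : mid F G x0 = (F x0 + G x0) / 2 by exact: midE.
suff : w * k * b <= 36 * d.
  rewrite mulrAC => h; rewrite -(ler_pM2l (mulr_gt0 w0 b0)) (le_trans h)//.
  by move: d4; rewrite ler_pdivlMr// mulrC -mulrA [e * _]mulrC.
apply: (midpoint_slack b s ((b + (1 - G x0 ^+ 2)) / 2) ((s + (2 - Q G)) / 2)
  (mid F G x0 ^+ 2) (Q (mid F G)) (p (mid F G) ^+ 2)) => //.
- by rewrite ler_wpM2r// lerDl subr_ge0.
- by rewrite ler_wpM2r// lerDl subr_ge0.
- exact: sqr_ge0.
- exact: Q_ge0.
- by rewrite mulr_ge0// ltW.
- by rewrite Mx0; exact: midpoint_sqr_le.
- by apply: midpoint_sub_le; exact: Q_mid.
- apply: (@le_trans _ _ (((p F + p G) / 2) ^+ 2)).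
    rewrite ler_sqr ?nnegrE// ?divr_ge0// ?addr_ge0//.
    exact: (seminorm_mid X (fun=> Z) (fun=> Z1) (fun=> Z0)).
  by apply: midpoint_cauchy; rewrite // ?subr_ge0// ltW.
- move=> h1 h2; rewrite ltNge; apply/negP => h3.
  have : U ((1 + d) *: mid F G).
    have pe : p ((1 + d) *: mid F G) ^+ 2 = (1 + d) ^+ 2 * p (mid F G) ^+ 2.
      by rewrite pZ exprMn real_normK ?num_real.
    have xe : ((1 + d) *: mid F G) x0 ^+ 2 = (1 + d) ^+ 2 * mid F G x0 ^+ 2.
      by rewrite -exprMn.
    have Qe : Q ((1 + d) *: mid F G) <= (1 + d) ^+ 2 * Q (mid F G) by exact: QZ.
    split; rewrite ?xe// ?pe; first exact: le_trans Qe h2.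
    by apply: le_trans h3 _; rewrite ler_wpM2l ?subr_ge0// lerD2l lerN2.
  move=> /(gauge_ge _ x).
  rewrite -[((1 + d) *: mid F G) x]/((1 + d) * mid F G x) midE Fx Nx => h.
  by have := scaled_midpoint_gt1 d _ d0 d1 Gx; rewrite ltNge h.
Qed.

(** Local uniform rotundity at [F]. Small slacks give [r i G <= 3 e / 10], hence
    [r i (F - G) <= 4 e / 10], and evaluations that differ by at most [2 e / 10]; [net] adds these
    up to [e]. *)
Lemma dual_body_lur F x : U F -> F x = 1 -> gauge x = 1 -> 0 < p F ->
  forall e : R, 0 < e -> exists2 d, 0 < d &
    forall G, U G -> 1 - d < G x -> `|F - G| <= e.
Proof.
move=> UF Fx Nx pF e e0.
have e10 : 0 < e / 10 by rewrite divr_gt0.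
have [i [J [rF Jsing hJ]]] := net F (e / 10) e10.
have sl := slack_small F x UF Fx Nx pF.
have e20 : 0 < (e / 10) ^+ 2 by rewrite exprn_gt0.
have [d0 d00 hd0] := sl i _ e20.
have [d1 d10 hd1] : exists2 d, 0 < d & forall G, U G -> 1 - d < G x ->
    forall j, j \in J -> slack X A j F G <= (e / 10) ^+ 2.
  elim: J {Jsing hJ} => [|j J [d1 d10 hd1]]; first by exists 1.
  have [d2 d20 hd2] := sl j _ e20.
  exists (Num.min d1 d2); first by rewrite lt_min d10.
  move=> G UG Gx k; rewrite inE.
  have : Num.min d1 d2 <= d1 /\ Num.min d1 d2 <= d2 by rewrite !ge_min !lexx orbT.
  move=> [m1 m2] /predU1P[->|kJ]; first by apply: hd2 => //; lra.
  by apply: hd1 => //; lra.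
have sq_le (u : R) : (u / 2) ^+ 2 <= (e / 10) ^+ 2 -> `|u| <= 2 * (e / 10).
  rewrite -[X in X <= _]real_normK ?num_real// ler_sqr ?nnegrE ?(ltW e10)//.
  by rewrite normrM normfV (ger0_norm (ler0n _ 2)) => h; lra.
exists (Num.min d0 d1); first by rewrite lt_min d00.
move=> G UG Gx.
have [m1 m2] : Num.min d0 d1 <= d0 /\ Num.min d0 d1 <= d1 by rewrite !ge_min !lexx orbT.
have k0 := hd0 G UG ltac:(lra); have k1 := hd1 G UG ltac:(lra).
have rG : r i G <= 3 * (e / 10).
  have := sq_le _ (le_trans (slack_ge X A A1 A0 i F G) k0).
  by rewrite ler_norml => /andP[h1 h2]; lra.
have rFG : r i (F - G) <= 4 * (e / 10).
  apply: le_trans (seminormD X A A1 A0 i F (- G)) _.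
  by rewrite -[- G]scaleN1r (seminormZ X A A1 A0) normrN1 mul1r; lra.
(* On a singleton the seminorm is the modulus of an evaluation, and its slack is [(F y - G y)^2 / 4]
   by the parallelogram identity. *)
have rj j : j \in J -> r j (F - G) <= 2 * (e / 10).
  move=> jJ; have [y Aj] := Jsing _ jJ.
  have re H : r j H = `|H y|.
    by rewrite /seminorm Aj /sup_norm image_set1 sup1.
  rewrite re; apply: sq_le; apply: le_trans (k1 _ jJ).
  rewrite /slack !re midE !real_normK ?num_real// -[(F - G) y]/(F y - G y).
  by lra.
have := hJ (F - G) (2 * (e / 10)) ltac:(lra) rj; lra.
Qed.

(** Smulian's argument: functionals attaining the norm at [x + h] and [x - h] almost attain it at
    [x], so they are close to [F]. *)
Lemma gauge_frechet F x : U F -> F x = 1 -> gauge x = 1 -> 0 < p F ->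
  norm_frechet (renorm gauge_norm) x.
Proof.
move=> UF Fx Nx pF e e0.
have [m [M [m0 M0 mM]]] := gauge_equiv.
have me0 : 0 < e * m / 2 by rewrite divr_gt0// mulr_gt0.
have [d d0 hd] := dual_body_lur F x UF Fx Nx pF _ me0.
have d30 : 0 < d / 2 by rewrite divr_gt0.
exists (d / 2) => // h; rewrite -[X in X < _ -> _]/(gauge h).
rewrite -[leLHS]/(gauge (x + h) + gauge (x - h) - 2 * gauge x).
rewrite -[X in _ -> _ <= _ * X]/(gauge h) Nx => hh.
have gN y : gauge (- y) = gauge y by rewrite -scaleN1r gaugeZ normrN1 mul1r.
have key k : gauge k = gauge h -> exists G,
    [/\ U G, G (x + k) = gauge (x + k) & `|F - G| <= e * m / 2].
  move=> gk; have [G UG Gxk] := gauge_attained (x + k); exists G; split=> //.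
  apply: hd => //.
  have lb : 1 - gauge h <= gauge (x + k).
    have := gaugeD (x + k) (- k); rewrite addrK gN Nx gk; lra.
  have := gauge_ge G k UG; rewrite gk => h1.
  by move: Gxk; rewrite (linD G); last exact: dual_lin; lra.
have [G1 [U1 e1 n1]] := key h erefl.
have [G2 [U2 e2 n2]] := key (- h) (gN h).
have := gauge_ge _ x U1; have := gauge_ge _ x U2; rewrite Nx => g2 g1.
rewrite -e1 -e2 (linD G1 x h (dual_lin _ G1)) (linB G2 x h (dual_lin _ G2)).
have := dual_norm_ge _ (F - G1) h; have := dual_norm_ge _ (F - G2) h.
rewrite -[(F - G1) h]/(F h - G1 h) -[(F - G2) h]/(F h - G2 h).
rewrite !ler_norml => /andP[a1 a2] /andP[a3 a4].
have b1 := ler_wpM2r (@normr_ge0 _ X h) n1.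
have b2 := ler_wpM2r (@normr_ge0 _ X h) n2.
have b3 := ler_wpM2l (ltW e0) (mM h).1.
lra.
Qed.


Lemma dual_body_intro F (k : R) : 0 <= k -> F x0 ^+ 2 <= 1 - k -> Q F <= 3 / 2 ->
  p F ^+ 2 <= k / 2 -> U F.
Proof.
move=> k0 Fk QF pF; split; first by rewrite (le_trans Fk)// gerBl.
  by apply: le_trans QF _; lra.
by apply: le_trans pF _; apply: ler_pM; rewrite // lerBrDl; lra.
Qed.

(** Shrinking by [1 - k] makes the first factor at least [k], while [(9 / 8)^2 < 3 / 2] keeps the
    second at least [1 / 2]. *)
Lemma dual_body_perturb G (k : R) : G x0 = 0 -> 0 <= k -> k <= 1 / 2 ->
  `|G| <= 1 / 8 -> p G ^+ 2 <= k / 2 -> U ((1 - k) *: (f0 + G)).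
Proof.
move=> Gx0 k0 k12 G8 pG.
have q0 : 0 <= 1 - k by lra.
have q1 : 1 - k <= 1 by lra.
apply: (dual_body_intro _ k) => //.
- rewrite -[X in X ^+ 2]/((1 - k) * (f0 x0 + G x0)) f0x0 Gx0 addr0 mulr1 expr2.
  by rewrite ler_piMr.
- apply: le_trans (QF_le _) _; apply: (@le_trans _ _ ((9 / 8) ^+ 2)).
    rewrite ler_sqr ?nnegrE// normrZ (ger0_norm q0) -[leRHS]mul1r.
    apply: ler_pM => //; apply: le_trans (ler_normD _ _) _.
    by apply: le_trans (lerD f01 G8) _; lra.
  by rewrite expr2; lra.
- apply: le_trans pG; rewrite ler_sqr ?nnegrE// pZ (ger0_norm q0) -[leRHS]mul1r.
  by apply: ler_pM => //; apply: le_trans (pD _ _) _; rewrite pf0 add0r.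
Qed.

(** [p F = 0] forces [F = c *: f0] with [c] equal to [1] or [-1]. Perturbing [f0] by [t *: G] with
    [G x0 = 0] costs only [O(t^2)], so maximality of [f0] at [c *: x] gives [G x = 0], and [x] lies
    on the line through [x0]. *)
Lemma gauge_exceptional F x : U F -> F x = 1 -> gauge x = 1 -> p F = 0 ->
  x = x0 \/ x = - x0.
Proof.
move=> UF Fx Nx pF; have Ff0 := psep F pF; move: (F x0) (UF) Ff0 => c [c2 _ _] Ff0.
have cf : c * f0 x = 1 by rewrite -Fx [in RHS]Ff0.
have c1 : `|c| <= 1.
  rewrite -(@expr_le1 _ 2)// real_normK ?num_real//.
  by move: c2; rewrite Ff0 -[X in X ^+ 2 <= _]/(c * f0 x0) f0x0 mulr1.
have fx1 : `|f0 x| <= 1.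
  rewrite ler_norml -Nx gauge_ge// andbT lerNl.
  by apply: (gauge_ge (- f0)); apply: dual_bodyN.
have c21 : c ^+ 2 = 1 := norm_le1_mul1 c _ c1 fx1 cf.
have fxc : f0 x = c by rewrite -[LHS]mul1r -c21 expr2 -mulrA cf mulr1.
have cc : c = 1 \/ c = -1.
  by move/eqP: c21; rewrite sqrf_eq1 => /orP[/eqP|/eqP]; [left|right].
have Ncx : gauge (c *: x) = 1.
  by rewrite gaugeZ Nx mulr1; case: cc => ->; rewrite ?normrN1 ?normr1.
have flat G : G x0 = 0 -> c * G x <= 0.
  (* With this constant, [p (t *: G) ^+ 2 <= k / 2] for the shrinking [k] below. *)
  move=> Gx0; apply: (flat_at_maximum (2 * `|G| ^+ 2 + 1) `|G|) => //.
  move=> t t0 tG Kt; set k := (2 * `|G| ^+ 2 + 1) * t ^+ 2 in Kt *.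
  have k0 : 0 <= k by rewrite mulr_ge0 ?sqr_ge0// addr_ge0// mulr_ge0// sqr_ge0.
  have : U ((1 - k) *: (f0 + t *: G)).
    apply: dual_body_perturb => //.
    - by rewrite -[LHS]/(t * G x0) Gx0 mulr0.
    - by rewrite normrZ gtr0_norm.
    - rewrite pZ exprMn real_normK ?num_real// /k mulrC ler_pdivlMr//.
      have pG2 : p G ^+ 2 <= `|G| ^+ 2 by rewrite ler_sqr ?nnegrE.
      rewrite mulrAC ler_wpM2r ?sqr_ge0//; lra.
  move=> /(gauge_ge _ (c *: x)); rewrite Ncx.
  rewrite -[X in X <= _]/((1 - k) * (f0 (c *: x) + t * G (c *: x))).
  by rewrite (linZ f0 c x (dual_lin _ f0)) (linZ G c x (dual_lin _ G)) cf.
have kill G : G x0 = 0 -> G x = 0.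
  move=> Gx0; have h1 := flat G Gx0; have := flat (- G).
  rewrite -[(- G) x0]/(- G x0) Gx0 oppr0 -[(- G) x]/(- G x) => /(_ erefl) h2.
  have cG : c * G x = 0.
    by apply/le_anti; rewrite h1 -oppr_le0 -mulrN h2.
  by rewrite -[G x]mul1r -c21 expr2 -mulrA cG mulr0.
have xe : x = c *: x0.
  apply/eqP; rewrite -subr_eq0; apply/eqP.
  have [h [lh hle hx]] := norming X (x - c *: x0).
  have [H Hh] : exists H : dual X, forall z, H z = h z.
    by apply: (lin_dual X h 1) => // z; rewrite mul1r.
  have : (H - H x0 *: f0) x = 0.
    apply: kill; rewrite -[LHS]/(H x0 - H x0 * f0 x0) f0x0 mulr1.
    by rewrite subrr.
  rewrite -[LHS]/(H x - H x0 * f0 x) fxc => e; apply/normr0_eq0.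
  by rewrite -hx -Hh (linB H x _ (dual_lin _ H)) (linZ H _ _ (dual_lin _ H)) mulrC.
by case: cc xe => -> ->; rewrite ?scale1r ?scaleN1r; [left|right].
Qed.

(** Functionals attaining the norm at [x0 + y / (k + 1)] dominate [h] at [y] and cluster at some [G]
    with [G x0 = 1], that is, at [f0]. *)
Lemma gauge_support_x0 (h : X -> R) : supports (renorm gauge_norm) h x0 ->
  forall y, h y = f0 y.
Proof.
move=> [lh hle hx0].
have hgauge y : h y <= gauge y by exact: hle.
have lhX : @lin R X h by exact: lh.
suff main y : h y <= f0 y.
  move=> y; apply/le_anti; rewrite main/= -lerN2 -(linN h)//.
  by rewrite -(linN f0) ?main//; exact: dual_lin.
have /choice[g gP] (k : nat) : exists G,
    U G /\ G (x0 + k.+1%:R^-1 *: y) = gauge (x0 + k.+1%:R^-1 *: y).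
  by have [G UG e] := gauge_attained (x0 + k.+1%:R^-1 *: y); exists G.
have gk k : 1 + k.+1%:R^-1 * h y <= g k x0 + k.+1%:R^-1 * g k y.
  have [Ug ge] := gP k; have := hgauge (x0 + k.+1%:R^-1 *: y).
  rewrite -ge (linD h)// (linZ h)// hx0 (linD (g k)); last exact: dual_lin.
  by rewrite (linZ (g k)); last exact: dual_lin.
have gx0 k : g k x0 <= 1 by rewrite -gauge_x0; apply: gauge_ge; exact: (gP k).1.
have [G UG hG] := dual_body_cluster X A Z x0 A1 A0 Aball Z1 Z0 g (fun k => (gP k).1).
have Gy : h y <= G y.
  apply: hG; exists 0 => k _; have k0 : (0 : R) < k.+1%:R^-1 by rewrite invr_gt0.
  rewrite -(ler_pM2l k0); move: (gk k) (gx0 k) => h1 h2.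
  by rewrite -(lerD2l 1); apply: le_trans h1 _; rewrite lerD2r.
suff Gx0 : G x0 = 1 by rewrite -(dual_body_eq_f0 G UG Gx0).
apply/le_anti; rewrite -{1}gauge_x0 gauge_ge//=.
apply/ler_addgt0Pr => e e0; rewrite -lerBlDr; apply: hG.
(* [C] bounds [g k y - h y], so [g k x0 >= 1 - C / (k + 1)]. *)
pose C := `|h y| + 2 * `|y| + 1.
have C0 : 0 < C by rewrite ltr_wpDl// addr_ge0// mulr_ge0.
have [n0 _ hn] := near_infty_natSinv_lt (PosNum (divr_gt0 e0 C0)).
exists n0 => k n0k; have := hn _ n0k; rewrite /= ltr_pdivlMr// => hk.
have k0 : (0 : R) < k.+1%:R^-1 by rewrite invr_gt0.
have d1 : g k y - h y <= C.
  have := dual_body_le X A Z x0 A1 A0 Aball (g k) y (gP k).1.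
  have := ler_norm (g k y); have := ler_norm (- h y); rewrite normrN /C => a1 a2 a3.
  lra.
move: (gk k) (ler_wpM2l (ltW k0) d1) hk; move: (k.+1%:R^-1) => s h1 h2 hk.
lra.
Qed.

Lemma gauge_almost_frechet : almost_frechet (renorm gauge_norm).
Proof.
exists (f0 : renorm gauge_norm -> R); split; first exact: (dual_lin X f0).
move=> y y1; have gy : gauge y = 1 by exact: y1.
have [F UF Fy] := gauge_attained y; rewrite gy in Fy.
have [pF|pF] := eqVneq (p F) 0; last first.
  by left; apply: (gauge_frechet F) => //; rewrite lt_def pF p_ge0.
right => g sg; have [yx|yx] := gauge_exceptional F y UF Fy gy pF.
  by left; apply: gauge_support_x0; rewrite -yx.
have [lg gle g1] := sg.
right => z; rewrite -(gauge_support_x0 (fun z => -1 * g z + 0 * g z)); first by ring.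
split.
- exact: lin_comb.
- move=> w; rewrite mul0r addr0 mulN1r -(linN g)// -(@normrN _ (renorm gauge_norm) w).
  exact: gle.
- by rewrite mul0r addr0 mulN1r -(linN g)// -g1 yx.
Qed.

(** Bound the norm below at [x0 + t u] by [(1 - e) *: (f0 + G / 8)] and at [x0 - t u] by [f0]. The
    sum exceeds [2] by a fixed multiple of [t], however small [t] is. *)
Lemma gauge_not_frechet : ~ norm_frechet (renorm gauge_norm) x0.
Proof.
move=> /(_ (1 / 64)) []; first by rewrite divr_gt0.
move=> d d0 hd.
have [t [t0 t1 td]] : exists t : R, [/\ 0 < t, t <= 1 & t <= d / 4].
  exists (Num.min 1 (d / 4)); split; rewrite ?ge_min ?lexx ?orbT//.
  by rewrite lt_min ltr01 divr_gt0.
have [e [e0 e1 ee]] : exists e : R, [/\ 0 < e, e <= 1 / 2 & e * 200 = t].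
  exists (t / 200); split; rewrite ?divr_gt0 ?divfK//.
  by rewrite ler_pdivrMr//; apply: le_trans t1 _; lra.
have [G [u [Gx0 G1 u1 Gu pG]]] := weak_null e e0.
pose H : dual X := (1 - e) *: (f0 + (1 / 8 : R) *: G).
have Hx y : H y = (1 - e) * (f0 y + 1 / 8 * G y) by [].
have UH : U H.
  apply: dual_body_perturb => //.
  - by rewrite -[LHS]/(1 / 8 * G x0) Gx0 mulr0.
  - exact: ltW.
  - by rewrite normrZ ger0_norm//; lra.
  - rewrite pZ exprMn real_normK ?num_real//.
    have pG2 : p G ^+ 2 <= e ^+ 2 by rewrite ler_sqr ?nnegrE// ltW.
    have e2 : e ^+ 2 <= e * (1 / 2) by rewrite expr2 ler_pM2l.
    have e3 := sqr_ge0 e.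
    by rewrite expr2; lra.
have ht : gauge (t *: u) < d.
  apply: le_lt_trans (gauge_le _) _; rewrite normrZ gtr0_norm//.
  have : t * `|u| <= t * 1 by rewrite ler_pM2l.
  by move=> h; lra.
have := hd (t *: u) ht.
rewrite -[leLHS]/(gauge (x0 + t *: u) + gauge (x0 - t *: u) - 2 * gauge x0).
rewrite -[X in _ <= _ * X -> _]/(gauge (t *: u)) gauge_x0.
have g1 := gauge_ge H (x0 + t *: u) UH; have g2 := gauge_ge f0 (x0 - t *: u) U_f0.
have lH := dual_lin X H; have lf := dual_lin X f0.
rewrite (linD H _ _ lH) (linZ H _ _ lH) !Hx Gx0 f0x0 in g1.
rewrite (linB f0 _ _ lf) (linZ f0 _ _ lf) f0x0 in g2.
have g3 : gauge (t *: u) <= 2 * t.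
  apply: le_trans (gauge_le _) _; rewrite normrZ gtr0_norm//.
  by rewrite ler_pM2l// -[leRHS]mulr1 ler_pM2l.
have fu : f0 u <= 1.
  by apply: le_trans (ler_norm _) _; apply: le_trans (dual_le _ _ _ u1) f01.
have gu : G u <= 1.
  by apply: le_trans (ler_norm _) _; apply: le_trans (dual_le _ _ _ u1) G1.
move=> g4; apply: (kink_estimate e t (f0 u) (G u) t0 t1 ee Gu gu fu).
lra.
Qed.

Lemma gauge_norm_MIP : seq_complete X ->
  hereditary_MIP (renorm gauge_norm) /\ ~ frechet_smooth (renorm gauge_norm).
Proof.
move=> Xc; split; last first.
  move=> /(_ x0 gauge_x0) /frechet_smooth_norm_frechet h.
  by apply: gauge_not_frechet; apply: h; exact: gauge_x0.
apply: almost_frechet_hereditary_MIP; last exact: gauge_almost_frechet.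
  exact: seq_complete_renorm.
exists (x0 : renorm gauge_norm); apply/eqP => x00.
have x00' : x0 = 0 :> X by exact: x00.
by have := gauge_le x0; rewrite gauge_x0 x00' normr0 mulr0 ler10.
Qed.

End gauge.

(** * Spaces with a separable dual *)

Section separable_dual.
Context {R : realType} (X : normedModType R).
Implicit Types (F G H : dual X) (x y z : X).

Lemma dualB F x y : F (x - y) = F x - F y.
Proof. by apply: linB; exact: dual_lin. Qed.

Lemma dualZ F (a : R) x : F (a *: x) = a * F x.
Proof. by apply: linZ; exact: dual_lin. Qed.

Lemma separable_dual_sequence : separable (dual X) ->
  exists e : nat -> dual X, forall F (d : R), 0 < d -> exists i, `|F - e i| < d.
Proof.
move=> [S /countable_injP[f finj] dS].
(* An inverse of the injection [f]; numbers outside its image give [0]. *)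
exists (fun n => xget 0 [set s | S s /\ f s = n]) => F d d0.
have [||G [FG SG]] := dS (ball F d).
- by exists F; exact: ballxx.
- exact: ball_open.
exists (f G); have /(xgetPex 0) : exists s, [set s | S s /\ f s = f G] s by exists G.
set s := xget _ _ => -[Ss fs].
have -> : s = G by apply: finj => //; exact/mem_set.
by move: FG; rewrite -ball_normE.
Qed.

(** Cut [S] into finitely many cells on which [F] varies by at most [d], and take a net inside each
    cell for the other functionals. *)
Lemma finite_net (es : seq (dual X)) (S : set X) (d : R) : 0 < d ->
    (forall x, S x -> `|x| <= 1) ->
  exists ys : seq X, (forall y, y \in ys -> S y) /\
    forall x, S x -> exists2 y, y \in ys & forall F, F \in es -> `|F x - F y| <= d.
Proof.
move=> d0; elim: es S => [|F es IH] S S1.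
  have [->|/set0P[x Sx]] := eqVneq S set0; first by exists [::].
  exists [:: x]; split; first by move=> y; rewrite inE => /eqP ->.
  by move=> y _; exists x; rewrite ?inE.
have Fx x : S x -> `|F x| <= `|F| by move=> /S1; exact: dual_le.
have cells k : exists ys : seq X, (forall y, y \in ys -> S y) /\
    forall x, S x -> F x + `|F| < k%:R * d ->
    exists2 y, y \in ys & forall G, G \in F :: es -> `|G x - G y| <= d.
  elim: k => [|k [ys [ysS hys]]].
    exists [::]; split=> // x /Fx; rewrite ler_norml => /andP[h _].
    by rewrite mul0r ltNge -lerBlDr sub0r h.
  have [zs [zsS hzs]] := IH (S `&` [set x | k%:R * d <= F x + `|F| < k.+1%:R * d])
    (fun x Sx => S1 x Sx.1).
  exists (ys ++ zs); split.
    by move=> y; rewrite mem_cat => /orP[/ysS|/zsS[]].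
  move=> x Sx xk; have [xk'|xk'] := ltP (F x + `|F|) (k%:R * d).
    by have [y yys hy] := hys x Sx xk'; exists y => //; rewrite mem_cat yys.
  have [|y yzs hy] := hzs x; first by split; rewrite //= xk' xk.
  exists y; first by rewrite mem_cat yzs orbT.
  move=> G; rewrite inE => /predU1P[->|/hy//].
  have [_ /= /andP[y1 y2]] := zsS y yzs.
  move: xk y2; rewrite -natr1 mulrDl mul1r => x2 y2.
  by rewrite ler_norml; lra.
pose k := Num.bound ((`|F| + `|F|) / d).
have [ys [ysS hys]] := cells k; exists ys; split=> // x Sx; apply: hys => //.
have /archi_boundP : 0 <= (`|F| + `|F|) / d by rewrite divr_ge0// ?addr_ge0// ltW.
rewrite -/k ltr_pdivrMr// => h; apply: le_lt_trans h; rewrite lerD2r.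
exact: le_trans (ler_norm _) (Fx _ Sx).
Qed.

Lemma dual_norm_attained_half F : `|F| = 1 -> exists2 u, `|u| <= 1 & 1 / 2 <= F u.
Proof.
move=> F1; have h2 : (0 : R) < 1 / 2 by rewrite divr_gt0.
have hs : has_sup [set `|F x| | x in [set x : X | `|x| <= 1]].
  split; first by exists `|F 0|, 0; rewrite //= normr0.
  by exists `|F| => _ [x x1 <-]; exact: dual_le.
have [_ [x /= x1 <-]] := sup_adherent h2 hs.
rewrite (_ : sup _ = 1); last exact: F1.
move=> h; have [F0|F0] := ger0P (F x).
  by exists x => //; move: h; rewrite ger0_norm//; lra.
exists (- x); first by rewrite normrN.
by move: h; rewrite ltr0_norm// (linN F)//; [lra|exact: dual_lin].
Qed.

(** The list encodes a continuous finite rank operator, a substitute for a projection onto a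
    finite-dimensional subspace. *)
Definition finite_rank (L : seq (dual X * X)) x : X :=
  \sum_(q <- L) q.1 x *: q.2.

Lemma dual_complement G (L : seq (dual X * X)) :
  exists K : dual X, forall z, K z = G (z - finite_rank L z).
Proof.
have sumE (s : seq (dual X * X)) z :
    (\sum_(q <- s) G q.2 *: q.1) z = G (finite_rank s z).
  elim: s => [|q s IH].
    by rewrite /finite_rank !big_nil (lin0 _ (dual_lin _ G)).
  rewrite /finite_rank !big_cons (linD G _ _ (dual_lin _ G)).
  by rewrite -/(finite_rank s z) -IH dualZ mulrC.
by exists (G - \sum_(q <- L) G q.2 *: q.1) => z; rewrite dualB -sumE.
Qed.

(** As in Gram-Schmidt: to fix one more [y], add the residual [y - L y] with a normalized functional
    norming it, composed with [I - L] so as to vanish on the earlier vectors. *)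
Lemma finite_rank_fix (ys : seq X) :
  exists L, forall y, y \in ys -> finite_rank L y = y.
Proof.
elim: ys => [|y ys [L hL]]; first by exists [::].
pose y' := y - finite_rank L y.
have [y'0|y'0] := eqVneq y' 0.
  exists L => z; rewrite inE => /predU1P[->|/hL//].
  by apply/eqP; rewrite eq_sym -subr_eq0 -/y' y'0.
have [h [lh hle hy']] := norming X y'.
have [G Gh] : exists G : dual X, forall z, G z = h z.
  by apply: (lin_dual X h 1) => // z; rewrite mul1r.
have [K' K'E] := dual_complement G L.
pose K : dual X := `|y'|^-1 *: K'.
have KE z : K z = `|y'|^-1 * G (z - finite_rank L z) by rewrite -K'E.
exists ((K, y') :: L) => z; rewrite /finite_rank big_cons.
rewrite -/(finite_rank L z) [X in X *: _](KE z) -[(K, y').2]/y'.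
rewrite inE => /predU1P[->|/hL ->].
  by rewrite -/y' Gh hy' mulVf ?normr_eq0// scale1r subrK.
by rewrite subrr (lin0 _ (dual_lin _ G)) mulr0 scale0r add0r.
Qed.

(** Some [x] is moved by [L]; a functional norming [x - L x], composed with [I - L], is nonzero and
    kills [ys]. *)
Lemma vanishing_functional (ys : seq X) : infinite_dimensional X ->
  exists G u, [/\ `|G| = 1, `|u| <= 1, 1 / 2 <= G u & forall y, y \in ys -> G y = 0].
Proof.
move=> Xinf; have [L hL] := finite_rank_fix ys.
have [x xL] : exists x, x != finite_rank L x.
  apply: contrapT => h; apply: (Xinf (size L) (fun i => (tnth (in_tuple L) i).2)).
  move=> x; exists (fun i => (tnth (in_tuple L) i).1 x).
  rewrite -[LHS](_ : finite_rank L x = x).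
    by rewrite /finite_rank big_tnth.
  by apply/eqP/negPn/negP => hx; apply: h; exists x; rewrite eq_sym.
pose x' := x - finite_rank L x.
have x'0 : x' != 0 by rewrite subr_eq0.
have [h [lh hle hx']] := norming X x'.
have [K Kh] : exists K : dual X, forall z, K z = h z.
  by apply: (lin_dual X h 1) => // z; rewrite mul1r.
have [G0 G0E] := dual_complement K L.
have G0n0 : G0 != 0.
  apply/eqP => G00; have : G0 x = 0 by rewrite G00.
  by rewrite G0E Kh hx' => /eqP; rewrite normr_eq0 (negPf x'0).
pose G := `|G0|^-1 *: G0.
have G1 : `|G| = 1 by rewrite /G normfZV.
have [u u1 Gu] := dual_norm_attained_half G G1.
exists G, u; split=> // y /hL yL.
by rewrite -[LHS]/(`|G0|^-1 * G0 y) G0E yL subrr (lin0 _ (dual_lin _ K)) mulr0.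
Qed.

End separable_dual.

(** * The seminorms built from a dense sequence of functionals *)

Section construction.
Context {R : realType} (X : normedModType R).
Variable e : nat -> dual X.
Hypothesis e_dense : forall (F : dual X) (d : R), 0 < d -> exists i, `|F - e i| < d.
Hypothesis Xinf : infinite_dimensional X.
Implicit Types (F G H : dual X) (x y z : X).

(* On the weak neighbourhood [slab n] of [0] every functional is eventually
   small, and the ball is covered by finitely many translates of its double. So
   the seminorms [sup over (slab n)] play the role of the distances to the spans
   of [e 0], ..., [e n-1] in the classical dual LUR norm. *)
Definition slab n : set X :=
  [set z | `|z| <= 1 /\ forall i, (i < n)%N -> `|e i z| <= n.+1%:R^-1].

Lemma slab0 n : slab n 0.
Proof.
split=> [|i _]; rewrite ?normr0//.
by rewrite (lin0 _ (dual_lin _ (e i))) normr0 invr_ge0.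
Qed.

Lemma slab_small F (d : R) : 0 < d ->
  exists n, forall z, slab n z -> `|F z| <= d.
Proof.
move=> d0; have d20 : 0 < d / 2 by rewrite divr_gt0.
have [i hi] := e_dense F _ d20.
have [n0 _ hn] := near_infty_natSinv_lt (PosNum d20).
exists (maxn n0 i.+1) => z [z1 hz].
have -> : F z = (F - e i) z + e i z by rewrite -[(F - e i) z]/(F z - e i z) subrK.
rewrite [leRHS]splitr (le_trans (ler_normD _ _))// lerD//.
  by apply: le_trans (ltW hi); exact: dual_le.
apply: le_trans (hz i _) _; first by rewrite leq_max ltnSn orbT.
by apply: ltW; apply: hn; rewrite /= leq_maxl.
Qed.

(** Halving brings the differences, of norm up to [2], back into the unit ball. *)
Lemma slab_net_ex n : exists ys : seq X, (forall y, y \in ys -> `|y| <= 1) /\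
  forall x, `|x| <= 1 -> exists2 y, y \in ys & slab n ((2^-1 : R) *: (x - y)).
Proof.
have n0 : (0 : R) < n.+1%:R^-1 by rewrite invr_gt0.
have [ys [ys1 hys]] :=
  finite_net X [seq e i | i <- iota 0 n] [set x | `|x| <= 1] _ n0 (fun x h => h).
exists ys; split=> // x x1; have [y yys hy] := hys x x1; exists y => //; split.
  rewrite normrZ ger0_norm//; have := ler_normB x y; have := ys1 y yys.
  by rewrite /= => h1 h2; lra.
move=> i ni; rewrite dualZ dualB normrM ger0_norm//.
apply: (@le_trans _ _ (1 * n.+1%:R^-1)); last by rewrite mul1r.
apply: ler_pM => //; first lra.
by apply: hy; apply/mapP; exists i; rewrite // mem_iota.
Qed.

Definition slab_net n : seq X := sval (cid (slab_net_ex n)).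

Lemma slab_net_le n y : y \in slab_net n -> `|y| <= 1.
Proof. exact: (svalP (cid (slab_net_ex n))).1. Qed.

Lemma slab_netP n x : `|x| <= 1 ->
  exists2 y, y \in slab_net n & slab n ((2^-1 : R) *: (x - y)).
Proof. exact: (svalP (cid (slab_net_ex n))).2. Qed.

Lemma slab_net_nth n j : `|nth 0 (slab_net n) j| <= 1.
Proof.
have [h|h] := ltnP j (size (slab_net n)); last by rewrite nth_default// normr0.
by apply: slab_net_le; exact: mem_nth.
Qed.

Lemma slab_net_norm n H (c s : R) : (forall z, slab n z -> `|H z| <= s) ->
  (forall y, y \in slab_net n -> `|H y| <= c) -> `|H| <= 2 * s + c.
Proof.
move=> Hs Hc; apply: sup_norm_le; first by exists 0; rewrite /= normr0.
move=> x /(slab_netP n)[y yn /Hs].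
rewrite dualZ dualB normrM ger0_norm// => h.
have -> : H x = (H x - H y) + H y by rewrite subrK.
by rewrite (le_trans (ler_normD _ _))//; have := Hc y yn => h2; lra.
Qed.

(** [None] stands for numbers that code nothing; its seminorm is zero. *)
Definition slab_or_point (k : option (nat + nat * nat)) : set X :=
  match k with
  | Some (inl n) => slab n
  | Some (inr (n, j)) => [set nth 0 (slab_net n) j]
  | None => [set 0]
  end.

(** Index [0] is the whole ball, so that [Q] dominates half the squared dual norm. *)
Definition slabs_points (i : nat) : set X :=
  if i is i'.+1 then slab_or_point (unpickle i') else [set z | `|z| <= 1].

Lemma slabs_points_le i z : slabs_points i z -> `|z| <= 1.
Proof.
case: i => [//|i] /=; case: (unpickle i) => [[n|[n j]]|] /=.
- by case.
- by move=> ->; exact: slab_net_nth.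
- by move=> ->; rewrite normr0.
Qed.

Lemma slabs_points_neq0 i : slabs_points i !=set0.
Proof.
case: i => [|i] /=; first by exists 0; rewrite /= normr0.
case: (unpickle i) => [[n|[n j]]|] /=.
- by exists 0; exact: slab0.
- by exists (nth 0 (slab_net n) j).
- by exists 0.
Qed.

Lemma slabs_points_net F (d : R) : 0 < d -> exists i (J : seq nat),
  [/\ seminorm X slabs_points i F <= d,
      forall j, j \in J -> exists y, slabs_points j = [set y] &
    forall H c, 0 <= c -> (forall j, j \in J -> seminorm X slabs_points j H <= c) ->
      `|H| <= 2 * seminorm X slabs_points i H + c].
Proof.
move=> d0; have [n hn] := slab_small F d d0.
pose inj (u : nat + nat * nat) := (pickle u).+1.
have slabE : slabs_points (inj (inl n)) = slab n.
  by rewrite -[LHS]/(slab_or_point (unpickle (pickle _))) pickleK.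
have ptE j : slabs_points (inj (inr (n, j))) = [set nth 0 (slab_net n) j].
  by rewrite -[LHS]/(slab_or_point (unpickle (pickle _))) pickleK.
exists (inj (inl n)), [seq inj (inr (n, j)) | j <- iota 0 (size (slab_net n))]; split.
- by apply: seminorm_le; [exact: slabs_points_neq0|rewrite slabE].
- by move=> _ /mapP[j _ ->]; exists (nth 0 (slab_net n) j).
- move=> H c c0 hc; apply: (slab_net_norm n).
    by rewrite -slabE => z Az; apply: (seminorm_ge X _ slabs_points_le).
  move=> y /(nthP 0)[j jn <-].
  apply: le_trans (hc (inj (inr (n, j))) _); last by apply/mapP; exists j; rewrite // mem_iota.
  by apply: (seminorm_ge X _ slabs_points_le); rewrite ptE.
Qed.

Section base_point.
Variables (x0 : X) (f0 : dual X).
Hypotheses (x01 : `|x0| = 1) (f01 : `|f0| <= 1) (f0x0 : f0 x0 = 1).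

Definition net_point m : X :=
  if unpickle m is Some (n, j) then nth 0 (slab_net n) j else 0.

Lemma net_point_le m : `|net_point m| <= 1.
Proof.
rewrite /net_point; case: (unpickle m) => [[n j]|]; first exact: slab_net_nth.
by rewrite normr0.
Qed.

Lemma net_pointP n y : y \in slab_net n -> exists m, net_point m = y.
Proof.
move=> /(nthP 0)[j jn <-]; exists (pickle (n, j)).
by rewrite /net_point pickleK.
Qed.

(** Net points projected along [x0] onto the kernel of [f0], so that [p f0 = 0], and scaled to tend
    to [0], so that on bounded sets finitely many values nearly determine [p]. *)
Definition shrunk_point m : X :=
  (2^-1 ^+ m.+1 : R) *: (net_point m - f0 (net_point m) *: x0).

Lemma shrunk_point_le m : `|shrunk_point m| <= 2^-1 ^+ m.
Proof.
rewrite /shrunk_point normrZ ger0_norm ?exprn_ge0// exprSr -mulrA.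
rewrite ler_piMr ?exprn_ge0//.
have h1 := net_point_le m; have h2 : `|f0 (net_point m)| <= 1 := le_trans (dual_le X f0 _ h1) f01.
have := ler_normB (net_point m) (f0 (net_point m) *: x0).
rewrite normrZ x01 mulr1 => h3.
rewrite mulrC ler_pdivrMr// mul1r (le_trans h3)// (le_trans (lerD h1 h2))//; lra.
Qed.

Lemma shrunk_pointE F m : F (shrunk_point m) =
  2^-1 ^+ m.+1 * (F (net_point m) - f0 (net_point m) * F x0).
Proof. by rewrite dualZ dualB dualZ. Qed.

Local Notation Z := (range shrunk_point).
Local Notation p := (seminorm X (fun=> Z) 0).

Let Z1 z : Z z -> `|z| <= 1.
Proof.
move=> [m _ <-]; apply: le_trans (shrunk_point_le m) _.
by rewrite exprn_ile1//; lra.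
Qed.

Let Z0 : Z !=set0. Proof. by exists (shrunk_point 0), 0. Qed.

Let p_ge F m : `|F (shrunk_point m)| <= p F.
Proof. by apply: (seminorm_ge X (fun=> Z) (fun=> Z1)); exists m. Qed.

Let pf0 : p f0 = 0.
Proof.
apply/le_anti/andP; split; last first.
  exact: (seminorm_ge0 X (fun=> Z) (fun=> Z1) (fun=> Z0)).
apply: seminorm_le => // _ [m _ <-].
by rewrite shrunk_pointE f0x0 mulr1 subrr mulr0 normr0.
Qed.

(** [p F = 0] makes [F - F x0 *: f0] vanish on every net; a slab on which it is small then bounds
    its norm by any [d]. *)
Lemma seminorm_eq0_multiple F : p F = 0 -> F = F x0 *: f0.
Proof.
move=> pF; apply/eqP; rewrite -subr_eq0 -normr_le0; apply/ler_addgt0Pr => d d0.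
rewrite add0r; set H := F - F x0 *: f0.
have d20 : 0 < d / 2 by rewrite divr_gt0.
have [n hn] := slab_small H _ d20.
have Hnet y : y \in slab_net n -> `|H y| <= 0.
  move=> /net_pointP[m <-].
  have := p_ge F m; rewrite pF shrunk_pointE normr_le0 mulf_eq0.
  rewrite expf_eq0 invr_eq0 pnatr_eq0 andbF /= => /eqP h.
  rewrite -[leLHS]/(`|F (net_point m) - F x0 * f0 (net_point m)|).
  by rewrite [F x0 * _]mulrC h normr0.
by have := slab_net_norm n H 0 (d / 2) hn Hnet; rewrite addr0 => h; lra.
Qed.

(** Annihilate [x0] and the first [m0] net points; the remaining shrunk points have norm at most
    [2^-m0]. *)
Lemma seminorm_weak_null (d : R) : 0 < d -> exists G u,
  [/\ G x0 = 0, `|G| <= 1, `|u| <= 1, 1 / 2 <= G u & p G <= d].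
Proof.
move=> d0.
have [m0 hm] : exists m0, (2^-1 : R) ^+ m0 <= d.
  have h2 : `|2^-1 : R| < 1 by rewrite ger0_norm//; lra.
  have /cvgrPdist_lt/(_ _ d0)[m0 _ /(_ m0 (leqnn _))] := cvg_expr h2.
  rewrite /= sub0r normrN ger0_norm ?exprn_ge0// => h.
  by exists m0; exact: ltW.
have [G [u [G1 u1 Gu G0]]] := vanishing_functional X
  (x0 :: [seq net_point m | m <- iota 0 m0]) Xinf.
exists G, u; have Gx0 : G x0 = 0 by apply: G0; rewrite inE eqxx.
split; rewrite ?G1//; apply: seminorm_le => // _ [m _ <-].
have [mm|mm] := ltnP m m0.
  rewrite shrunk_pointE Gx0 mulr0 subr0 G0 ?mulr0 ?normr0 ?ltW//.
  by rewrite inE; apply/orP; right; apply/mapP; exists m; rewrite // mem_iota.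
apply: le_trans (dual_norm_ge _ G _) _; rewrite G1 mul1r.
apply: le_trans (shrunk_point_le m) _; apply: le_trans hm.
by rewrite ler_wiXn2l//; lra.
Qed.

Lemma renorming_at : seq_complete X -> exists N : equiv_norm X,
  hereditary_MIP (renorm N) /\ ~ frechet_smooth (renorm N).
Proof.
move=> Xc; eexists.
apply: (gauge_norm_MIP X slabs_points Z x0 f0 slabs_points_le slabs_points_neq0
  _ Z1 Z0 f01 f0x0 _ pf0) => //.
- by rewrite x01.
- exact: seminorm_eq0_multiple.
- exact: slabs_points_net.
- exact: seminorm_weak_null.
Unshelve. all: by [].
Qed.

End base_point.
End construction.

Lemma separable_dual_renorming {R : realType} (X : completeNormedModType R) :
  infinite_dimensional X -> separable (dual X) -> exists N : equiv_norm X,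
  hereditary_MIP (renorm N) /\ ~ frechet_smooth (renorm N).
Proof.
move=> Xinf /separable_dual_sequence[e e_dense].
have [G [u [G1 _ Gu _]]] := vanishing_functional X [::] Xinf.
have un0 : u != 0.
  by apply/eqP => u0; move: Gu; rewrite u0 (lin0 _ (dual_lin _ G)) => h; lra.
pose x0 := `|u|^-1 *: u.
have x01 : `|x0| = 1 by rewrite normfZV.
have [f sf] := supportsP _ _ x01.
have [f0 /duality_mapP-/(_ x01)[_ fle fx] _] := supports_dual _ _ _ x01 sf.
apply: (renorming_at X e e_dense Xinf x0 f0 x01 _ fx) => //.
  by apply: dual_norm_le => // z; rewrite mul1r.
exact: complete_seq_complete.
Qed.

(** * The space c0 *)

Section c0_space.
Context (R : realType).
Implicit Types (u v : c0 R) (F : dual (c0 R)).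

Let unit_in k : (fun m : nat => (m == k)%:R : R^o) \in @c0_pred R.
Proof.
apply/asboolP; apply/cvgr0Pnorm_lt => d d0.
by exists k.+1 => // m /= km; rewrite gtn_eqF// normr0.
Qed.

Definition c0_unit k : c0 R := C0 (unit_in k).

Definition c0_trunc (c : nat -> R) n : c0 R := \sum_(k < n) c k *: c0_unit k.

Lemma c0_truncE c n m : c0_trunc c n m = if (m < n)%N then c m else 0.
Proof.
elim: n => [|n IH]; first by rewrite /c0_trunc big_ord0.
rewrite /c0_trunc big_ord_recr/= -[LHS]/(c0_trunc c n m + c n * (m == n)%:R) IH.
rewrite ltnS; case: (ltngtP m n) => [||->].
- by rewrite mulr0 addr0.
- by rewrite mulr0 addr0.
- by rewrite mulr1 add0r.
Qed.

Lemma c0_truncS c n : c0_trunc c n.+1 = c0_trunc c n + c n *: c0_unit n.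
Proof. by rewrite /c0_trunc big_ord_recr. Qed.

Lemma c0_trunc_norm_le c n (M : R) : 0 <= M -> (forall k, `|c k| <= M) ->
  `|c0_trunc c n| <= M.
Proof.
move=> M0 cM; apply: c0_norm_le => m; rewrite c0_truncE.
by case: ifP => // _; rewrite normr0.
Qed.

Lemma c0_trunc_cvg u (d : R) : 0 < d ->
  exists n0, forall n, (n0 <= n)%N -> `|u - c0_trunc u n| <= d.
Proof.
move=> d0; have /asboolP/cvgr0Pnorm_lt/(_ _ d0)[n0 _ hn] := c0P u.
exists n0 => n n0n; apply: c0_norm_le => m.
rewrite -[(u - c0_trunc u n) m]/(u m - c0_trunc u n m) c0_truncE.
case: ltnP => nm; first by rewrite subrr normr0 ltW.
by rewrite subr0; apply/ltW/hn; rewrite /= (leq_trans n0n).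
Qed.

Lemma dual_c0_trunc F c n : F (c0_trunc c n) = \sum_(k < n) c k * F (c0_unit k).
Proof.
elim: n => [|n IH].
  by rewrite /c0_trunc !big_ord0 (lin0 _ (dual_lin _ F)).
by rewrite c0_truncS big_ord_recr/= (linD F _ _ (dual_lin _ F)) IH dualZ.
Qed.

(** Evaluate [F] at the truncated sequence of signs of its coefficients. *)
Lemma dual_c0_summable F n : \sum_(k < n) `|F (c0_unit k)| <= `|F|.
Proof.
have -> : \sum_(k < n) `|F (c0_unit k)| =
    F (c0_trunc (fun k => Num.sg (F (c0_unit k))) n).
  by rewrite dual_c0_trunc; apply: eq_bigr => k _; rewrite -normrEsg.
apply: le_trans (ler_norm _) _; apply: dual_le; apply: c0_trunc_norm_le => // k.
by rewrite normr_sg; case: (_ != _).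
Qed.

(** Beyond [n] the coefficients of [F] have absolute sum at most [d]; replacing [u] by a long
    truncation costs at most [t]. *)
Lemma dual_c0_tail F (d : R) : 0 < d -> exists n, forall u,
  `|F u - \sum_(k < n) u k * F (c0_unit k)| <= d * `|u|.
Proof.
move=> d0; pose s n := \sum_(k < n) `|F (c0_unit k)|.
have sub : has_ubound (range s).
  by exists `|F| => _ [n _ <-]; exact: dual_c0_summable.
have [_ [n _ <-] hn] := sup_adherent d0 (conj (ex_intro _ (s 0) (ex_intro2 _ _ 0 I erefl)) sub).
exists n => u; apply/ler_addgt0Pr => t t0.
have t0' : 0 < t / (`|F| + 1) by rewrite divr_gt0// ltr_wpDl.
have [n0 hn0] := c0_trunc_cvg u _ t0'.
pose m := (n + n0)%N.
have -> : F u - \sum_(k < n) u k * F (c0_unit k) =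
    F (c0_trunc u m) - \sum_(k < n) u k * F (c0_unit k) + F (u - c0_trunc u m).
  by rewrite dualB; ring.
apply: le_trans (ler_normD _ _) _; apply: lerD.
  rewrite dual_c0_trunc /m big_split_ord/= addrAC subrr add0r.
  apply: le_trans (ler_norm_sum _ _ _) _.
  have smn : s m - s n <= d.
    have : s m <= sup (range s) by apply: ub_le_sup => //; exists m.
    by move: hn => /= h1 h2; lra.
  apply: (@le_trans _ _ ((s m - s n) * `|u|)); last by rewrite ler_wpM2r.
  rewrite /s /m big_split_ord/= addrAC subrr add0r mulr_suml.
  by apply: ler_sum => k _; rewrite normrM mulrC ler_wpM2l// c0_norm_ge.
apply: le_trans (dual_norm_ge _ F _) _.
have := hn0 m (leq_addl _ _); rewrite ler_pdivlMr ?ltr_wpDl//.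
have := normr_ge0 (u - c0_trunc u m); have := normr_ge0 F => h1 h2 h3.
by rewrite mulrC; apply: le_trans h3; rewrite ler_wpM2l// lerDl.
Qed.

Lemma c0_coordinate_ex k : exists F, forall u, F u = u k.
Proof.
apply: (lin_dual _ (fun u : c0 R => u k) 1) => [a u v//|u].
by rewrite mul1r; apply: le_trans (ler_norm _) (c0_norm_ge _ _).
Qed.

Definition c0_coordinate k : dual (c0 R) := sval (cid (c0_coordinate_ex k)).

Lemma c0_coordinateE k u : c0_coordinate k u = u k.
Proof. exact: (svalP (cid (c0_coordinate_ex k))). Qed.

Definition rat_functional (q : seq rat) : dual (c0 R) :=
  \sum_(k < size q) (ratr (nth 0 q k) : R) *: c0_coordinate k.

Lemma rat_functionalE q u :
  rat_functional q u = \sum_(k < size q) ratr (nth 0 q k) * u k.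
Proof.
rewrite /rat_functional; elim: (size q) => [|n IH]; first by rewrite !big_ord0.
by rewrite !big_ord_recr/= -IH -(c0_coordinateE n u).
Qed.

(** Finite rational combinations of coordinates are dense: a third of the radius pays for the tail,
    a third for rounding the first [n] coefficients. *)
Lemma separable_dual_c0 : separable (dual (c0 R)).
Proof.
exists (range rat_functional).
  by apply: sub_countable (countableP [set: seq rat]); exact: card_image_le.
move=> O [F OF] Oo.
have /nbhs_ballP[r /= r0 rO] : nbhs F O by exact: open_nbhs_nbhs.
have r30 : 0 < r / 3 by rewrite divr_gt0.
have [n hn] := dual_c0_tail F _ r30.
have n10 : (0 : R) < n.+1%:R by [].
pose d := r / 3 / n.+1%:R.
have d0 : 0 < d by rewrite divr_gt0.
have /choice[q qP] k : exists q : rat, `|F (c0_unit k) - ratr q| <= d.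
  have [|q] := @rat_in_itvoo R (F (c0_unit k) - d) (F (c0_unit k) + d); first by lra.
  by rewrite in_itv/= => /andP[h1 h2]; exists q; rewrite ler_norml; lra.
exists (rat_functional (mkseq q n)); split; last by exists (mkseq q n).
apply: rO; rewrite -ball_normE /=.
apply: (@le_lt_trans _ _ (r / 3 + r / 3)); last by lra.
apply: dual_norm_le; first by lra.
move=> u; rewrite -[leLHS]/(F u - rat_functional (mkseq q n) u) rat_functionalE.
rewrite size_mkseq.
have -> : F u - \sum_(k < n) ratr (nth 0 (mkseq q n) k) * u k =
    F u - \sum_(k < n) u k * F (c0_unit k) +
    \sum_(k < n) (F (c0_unit k) - ratr (q k)) * u k.
  rewrite -addrA; congr (_ + _); rewrite -[RHS]addrC -sumrB -sumrN.
  by apply: eq_bigr => k _; rewrite nth_mkseq//; ring.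
apply: le_trans (ler_norm _) _; apply: le_trans (ler_normD _ _) _.
rewrite mulrDl; apply: lerD; first exact: hn.
apply: le_trans (ler_norm_sum _ _ _) _.
apply: (@le_trans _ _ (\sum_(k < n) d * `|u|)).
  apply: ler_sum => k _; rewrite normrM; apply: ler_pM => //.
  exact: c0_norm_ge.
rewrite sumr_const card_ord -[leLHS]mulr_natl mulrA ler_wpM2r//.
by rewrite /d mulrA ler_pdivrMr// [_%:R * _]mulrC ler_pM2l// ler_nat.
Qed.

(** Expressing [n + 1] unit vectors by [n] vectors would factor the identity matrix of size [n + 1]
    through dimension [n]. *)
Lemma c0_infinite_dimensional : infinite_dimensional (c0 R).
Proof.
move=> n b hb.
have /choice[c cP] (k : 'I_n.+1) := hb (c0_unit k).
have sumE m (w : 'I_m -> R) (v : 'I_m -> c0 R) j :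
    (\sum_(i < m) w i *: v i) j = \sum_(i < m) w i * v i j.
  elim: m w v => [|m IH] w v; first by rewrite !big_ord0.
  rewrite !big_ord_recr/= -[RHS](congr1 (fun x => x + _) (IH _ _)).
  by [].
have : (\matrix_(k < n.+1, i < n) c k i) *m (\matrix_(i < n, j < n.+1) (b i j : R))
    = 1%:M.
  apply/matrixP => k j; rewrite !mxE.
  under eq_bigr do rewrite !mxE.
  by rewrite -sumE -cP /= eq_sym.
by move=> /mulmx1_min; rewrite ltnn.
Qed.

End c0_space.

Theorem corollary5 (R : realType) :
  [/\ forall (X : completeNormedModType R) (N : equiv_norm X),
        WCG X -> Asplund X ->
        smooth (renorm N) ->
        (exists x0 : renorm N, unit_sphere (renorm N) x0 /\
           non_frechet_set (renorm N) = [set x0; - x0]) ->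
        hereditary_MIP (renorm N) /\ ~ frechet_smooth (renorm N),
      forall X : completeNormedModType R,
        infinite_dimensional X -> separable (dual X) ->
        exists N : equiv_norm X,
          hereditary_MIP (renorm N) /\ ~ frechet_smooth (renorm N),
      separable (dual (c0 R)) &
      exists N : equiv_norm (c0 R),
        hereditary_MIP (renorm N) /\ ~ frechet_smooth (renorm N)].
Proof.
split.
- by move=> X N _ _; exact: two_point_hereditary_MIP.
- exact: separable_dual_renorming.
- exact: separable_dual_c0.
- exact: separable_dual_renorming (@c0_infinite_dimensional R) (@separable_dual_c0 R).
Qed.
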